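(* Let $(W,S)$ be a finitely generated Coxeter group, let $R=\mathbb{Z}[[q]]$ be the ring of formal power series over $\mathbb{Z}$ in the indeterminate $q$, and let $\mathcal{H}=\mathcal{H}_q(W,S)$ be the $\mathbb{Z}[[q]]$-Hecke algebra associated with $(W,S)$ and the element $q$, with standard basis $\mathcal{B}=\{T_w\mid w\in W\}$ and index representation $\varepsilon_q\colon\mathcal{H}\to\mathbb{Z}[[q]]$, $\varepsilon_q(T_w)=q^{\ell(w)}$. Then $(\mathcal{H},\mathcal{B},\varepsilon_q)$ is a $\mathbb{Z}[[q]]$-Euler algebra, and its Euler characteristic is $$\chi_{(\mathcal{H},\mathcal{B},\varepsilon_q)}=p_{(W,S)}(q)^{-1}\in\mathbb{Z}[[q]],$$ where $p_{(W,S)}(t)=\sum_{w\in W}t^{\ell(w)}\in\mathbb{Z}[[t]]$ is the Poincaré series of $(W,S)$.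
   Context: Coxeter groups. $(W,S)$ is a Coxeter system with $S=\{s_i\}$ finite (possibly empty): $W$ is generated by the involutions in $S$ subject to the relations $(s_is_j)^{m_{i,j}}=1$ for $i\neq j$ with $m_{i,j}\in\{2,3,\dots\}\cup\{\infty\}$ (no relation if $m_{i,j}=\infty$). $\ell\colon W\to\mathbb{N}_0$ is the length function with respect to $S$. Hecke algebras. For a commutative ring $R$ with unit and a distinguished element $q\in R$, the $R$-Hecke algebra $\mathcal{H}=\mathcal{H}_q(W,S)$ is the unique associative unital $R$-algebra which is a free $R$-module with basis $\mathcal{B}=\{T_w\mid w\in W\}$ (with unit $T_1$) subject to, for $s\in S$, $w\in W$: $T_sT_w=T_{sw}$ if $\ell(sw)>\ell(w)$, and $T_sT_w=(q-1)T_w+qT_{sw}$ if $\ell(sw)<\ell(w)$. The index representation $\varepsilon_q\colon\mathcal{H}\to R$ is the $R$-algebra homomorphism with $\varepsilon_q(T_s)=q$ for $s\in S$. Hattori–Stallings rank. For an associative unital $R$-algebra $\mathbf{A}$ let $[\mathbf{A},\mathbf{A}]$ be the $R$-span of all $ab-ba$, and $\underline{\mathbf{A}}=\mathbf{A}/[\mathbf{A},\mathbf{A}]$. For a finitely generated projective left $\mathbf{A}$-module $P$, with $P^*=\mathrm{Hom}_{\mathbf{A}}(P,\mathbf{A})$, let $\gamma_P\colon P^*\otimes_{\mathbf{A}}P\to\mathrm{End}_{\mathbf{A}}(P)$ be the isomorphism $\gamma_P(p^*\otimes p)(x)=p^*(x)p$, and $\mathrm{ev}_P(p^*\otimes p)=p^*(p)+[\mathbf{A},\mathbf{A}]$.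 The Hattori–Stallings rank of $P$ is $r_P=\mathrm{ev}_P(\gamma_P^{-1}(\mathrm{id}_P))\in\underline{\mathbf{A}}$. A left $\mathbf{A}$-module $M$ is of type FP if it has a resolution $P_\bullet\to M$ of finite length by finitely generated projective left $\mathbf{A}$-modules; its Hattori–Stallings rank is $r_M=\sum_k(-1)^kr_{P_k}\in\underline{\mathbf{A}}$ (independent of the resolution). Euler algebras. An $R$-Euler algebra is a triple $(\mathbf{A},\mathcal{B},\lambda)$ where $\mathbf{A}$ is an associative $R$-algebra, $\mathcal{B}\subseteq\mathbf{A}$ is a free $R$-basis containing $1$, and $\lambda\colon\mathbf{A}\to R$ is an $R$-algebra homomorphism, such that (i) the left $\mathbf{A}$-module $R_\lambda$ (equal to $R$ as $R$-module, with $a.r=\lambda(a)r$) is of type FP, and (ii) the $R$-linear map $\tilde\mu_{\mathcal{B}}\colon\mathbf{A}\to R$ with $\tilde\mu_{\mathcal{B}}(1)=1$ and $\tilde\mu_{\mathcal{B}}(b)=0$ for $b\in\mathcal{B}\setminus\{1\}$ satisfies $\tilde\mu_{\mathcal{B}}(xy)=\tilde\mu_{\mathcal{B}}(yx)$ for all $x,y\in\mathbf{A}$. Let $\mu_{\mathcal{B}}\colon\underline{\mathbf{A}}\to R$ be the map induced by $\tilde\mu_{\mathcal{B}}$. The Euler characteristic is $\chi_{(\mathbf{A},\mathcal{B},\lambda)}=\mu_{\mathcal{B}}(r_{R_\lambda})\in R$. *)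

(* Defs.v *)
From HB Require Import structures.
From mathcomp Require Import all_boot all_order all_algebra.
From mathcomp Require Import fingroup perm finmap all_classical.
From mathcomp Require Import generic_quotient ring_quotient freeg.

Set Implicit Arguments.
Unset Strict Implicit.
Unset Printing Implicit Defensive.

Import GRing.Theory.
Local Open Scope classical_set_scope.
Local Open Scope ring_scope.
Local Open Scope quotient_scope.

(* Formal power series, given by their coefficient sequences; the product
   [fps_mul] is the Cauchy product. *)
Record fps (R : Type) := Fps { fps_coef : nat -> R }.

Section FPS.
Variable R : comNzRingType.
Implicit Types f g h : fps R.

HB.instance Definition _ := gen_eqMixin (fps R).
HB.instance Definition _ := gen_choiceMixin (fps R).

Lemma fpsP f g : fps_coef f =1 fps_coef g -> f = g.
Proof. by case: f g => [f] [g] /= /funext ->. Qed.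

Definition fps_zero : fps R := Fps (fun=> 0).
Definition fps_one : fps R := Fps (fun n => (n == 0%N)%:R).
Definition fps_opp f := Fps (fun n => - fps_coef f n).
Definition fps_add f g := Fps (fun n => fps_coef f n + fps_coef g n).
Definition fps_mul f g :=
  Fps (fun n => \sum_(i < n.+1) fps_coef f i * fps_coef g (n - i)).

Lemma fps_addA : associative fps_add.
Proof. by move=> f g h; apply: fpsP => n /=; rewrite addrA. Qed.
Lemma fps_addC : commutative fps_add.
Proof. by move=> f g; apply: fpsP => n /=; rewrite addrC. Qed.
Lemma fps_add0 : left_id fps_zero fps_add.
Proof. by move=> f; apply: fpsP => n /=; rewrite add0r. Qed.
Lemma fps_addN : left_inverse fps_zero fps_opp fps_add.
Proof. by move=> f; apply: fpsP => n /=; rewrite addNr. Qed.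

HB.instance Definition _ :=
  GRing.isZmodule.Build (fps R) fps_addA fps_addC fps_add0 fps_addN.

Let trunc N f : {poly R} := \poly_(i < N) fps_coef f i.

Let truncM N f g n : (n < N)%N ->
  fps_coef (fps_mul f g) n = (trunc N f * trunc N g)`_n.
Proof.
move=> nN; rewrite coefM /=; apply: eq_bigr => i _.
rewrite !coef_poly (leq_ltn_trans _ nN); last by rewrite -ltnS.
by rewrite (leq_ltn_trans (leq_subr _ _) nN).
Qed.

Lemma fps_mulC : commutative fps_mul.
Proof. by move=> f g; apply: fpsP => n; rewrite !(truncM _ _ (ltnSn n)) mulrC. Qed.

Lemma fps_mulA : associative fps_mul.
Proof.
move=> f g h; apply: fpsP => n.
transitivity ((trunc n.+1 f * (trunc n.+1 g * trunc n.+1 h))`_n).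
  rewrite coefM /=; apply: eq_bigr => i _.
  rewrite coef_poly ltn_ord; congr (_ * _).
  by apply: (@truncM n.+1); rewrite ltnS leq_subr.
rewrite mulrA fps_mulC mulrC coefM /=; apply: eq_bigr => i _.
rewrite coef_poly ltn_ord; congr (_ * _).
by apply/esym/(@truncM n.+1); rewrite ltnS leq_subr.
Qed.

Lemma fps_mul1 : left_id fps_one fps_mul.
Proof.
move=> f; apply: fpsP => n /=; rewrite big_ord_recl /= mul1r subn0.
by rewrite big1 ?addr0// => i _; rewrite mul0r.
Qed.

Lemma fps_mulDl : left_distributive fps_mul fps_add.
Proof.
move=> f g h; apply: fpsP => n /=; rewrite -big_split /=.
by apply: eq_bigr => i _; rewrite mulrDl.
Qed.

Lemma fps_one_neq0 : fps_one != 0.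
Proof.
by apply/eqP => /(congr1 (fun f => fps_coef f 0)) /= /eqP; rewrite oner_eq0.
Qed.

HB.instance Definition _ := GRing.Zmodule_isComNzRing.Build (fps R)
  fps_mulA fps_mulC fps_mul1 fps_mulDl fps_one_neq0.

Definition fps_unit : pred (fps R) := fun f => `[< exists g, g * f = 1 >].
Definition fps_inv f : fps R := xget f [set g | g * f = 1].

Lemma fps_mulV : {in fps_unit, left_inverse 1 fps_inv *%R}.
Proof.
move=> f /asboolP fU; rewrite /fps_inv.
by case: xgetP => [g _ //|noinv]; case: fU => g /noinv.
Qed.
Lemma fps_unitP f g : g * f = 1 -> fps_unit f.
Proof. by move=> gf1; apply/asboolP; exists g. Qed.
Lemma fps_inv_out : {in [predC fps_unit], fps_inv =1 id}.
Proof.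
move=> f /negP fNU; rewrite /fps_inv; case: xgetP => [g _ gf1|//].
by case: fNU; apply/asboolP; exists g.
Qed.

HB.instance Definition _ := GRing.ComNzRing_hasMulInverse.Build (fps R)
  fps_mulV fps_unitP fps_inv_out.

Definition fpsX : fps R := Fps (fun n => (n == 1%N)%:R).

End FPS.

Section CoxeterRelations.
Variables (I : Type) (m : I -> I -> nat) (G : groupType) (s : I -> G).
Local Open Scope group_scope.

(* [m i j = 0] encodes an infinite entry: the relation [x ^+ 0 = 1] is void. *)
Definition coxeter_relations : Prop :=
  (forall i, s i * s i = 1) /\ (forall i j, i <> j -> (s i * s j) ^+ m i j = 1).

End CoxeterRelations.

(* [cox_rel], [cox_generated] and [cox_universal] say that the group is the one
   presented by the generators [cox_gen] and the Coxeter relations. *)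
Record coxeter_system := CoxeterSystem {
  cox_group :> groupType;
  cox_index : finType;
  cox_matrix : cox_index -> cox_index -> nat;
  cox_gen : cox_index -> cox_group;
  cox_matrix_sym : forall i j, cox_matrix i j = cox_matrix j i;
  cox_matrix_off : forall i j, i <> j -> cox_matrix i j <> 1%N;
  cox_rel : coxeter_relations cox_matrix cox_gen;
  cox_generated : forall w : cox_group,
    exists l : seq cox_index, w = (\prod_(i <- l) cox_gen i)%g;
  cox_universal : forall (G : groupType) (f : cox_index -> G),
    coxeter_relations cox_matrix f ->
    exists phi : {multiplicative cox_group -> G}, forall i, phi (cox_gen i) = f i
}.
Arguments cox_gen : clear implicits.

Section Length.
Variable C : coxeter_system.
Implicit Type w : C.

Lemma word_exists w : exists n, `[< exists2 l : seq (cox_index C),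
  size l = n & w = (\prod_(i <- l) cox_gen C i)%g >].
Proof.
by have [l wl] := cox_generated w; exists (size l); apply/asboolP; exists l.
Qed.

Definition cox_length w : nat := ex_minn (word_exists w).

Lemma cox_lengthP w : exists2 l : seq (cox_index C),
  size l = cox_length w & w = (\prod_(i <- l) cox_gen C i)%g.
Proof. by rewrite /cox_length; case: ex_minnP => n /asboolP. Qed.

Lemma cox_length_le l : (cox_length (\prod_(i <- l) cox_gen C i)%g <= size l)%N.
Proof.
by rewrite /cox_length; case: ex_minnP => n _; apply; apply/asboolP; exists l.
Qed.

Lemma finite_length n : finite_set [set w | cox_length w = n].
Proof.
apply: (@sub_finite_set _ _
  ((fun t : n.-tuple (cox_index C) => (\prod_(i <- t) cox_gen C i)%g) @` setT)).
  move=> w /= wn; have [l ln ->] := cox_lengthP w.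
  have lP : size l == n by rewrite ln wn.
  by exists (Tuple lP).
exact/finite_image/finite_finset.
Qed.

(* By [finite_length], [fset_set] is here the actual set of elements of length
   [n]. *)
Definition poincare : fps int :=
  Fps (fun n => Posz #|` fset_set [set w | cox_length w = n] |).

End Length.

Section Basis.
Variables (R : comNzRingType) (M : lmodType R) (B : set M).

Definition expands (c : {fsfun M -> R with 0}) (x : M) : Prop :=
  [set` finsupp c] `<=` B /\ x = \sum_(b <- finsupp c) c b *: b.

(* [B] is a free basis: each [x] is a finite linear combination of elements of
   [B] with unique coefficients. *)
Definition is_basis : Prop := forall x, exists! c, expands c x.

Definition coords (x : M) : {fsfun M -> R with 0} :=
  xget [fsfun] [set c | expands c x].

(* For a basis [B], the linear map agreeing with [f] on [B]. *)
Definition linear_extension (f : M -> R) (x : M) : R :=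
  \sum_(b <- finsupp (coords x)) coords x b * f b.

Section BasisTheory.
Hypothesis basisB : is_basis.

Lemma coordsP x : expands (coords x) x.
Proof.
rewrite /coords; case: xgetP => [c _ cx|noc]; first exact: cx.
by have [c [/noc]] := basisB x.
Qed.

Lemma coords_uniq c x : expands c x -> coords x = c.
Proof.
move=> cx; have [d [_ duniq]] := basisB x.
by rewrite -(duniq _ cx) -(duniq _ (coordsP x)).
Qed.

Lemma linear_extension_id f b : B b -> linear_extension f b = f b.
Proof.
move=> Bb; pose c : {fsfun M -> R with 0} := [fsfun x in [fset b]%fset => 1].
have cb : c b = 1 by rewrite fsfunE inE eqxx.
have sc : finsupp c = [fset b]%fset.
  apply/fsetP => x; rewrite mem_finsupp fsfunE !inE.
  by have [_|_] := eqVneq x b; rewrite ?oner_eq0 ?eqxx.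
have /coords_uniq ec : expands c b.
  split; last by rewrite sc big_seq_fset1 cb scale1r.
  by rewrite sc => x /=; rewrite inE => /eqP ->.
by rewrite /linear_extension ec sc big_seq_fset1 cb mul1r.
Qed.

Lemma linear_extension_linear f : linear_for *%R (linear_extension f).
Proof.
move=> a x y; have [sx ex] := coordsP x; have [sy ey] := coordsP y.
pose D := (finsupp (coords x) `|` finsupp (coords y))%fset.
pose c : {fsfun M -> R with 0} :=
  [fsfun b in D => a * coords x b + coords y b].
have cE b : c b = a * coords x b + coords y b.
  rewrite fsfunE; case: ifPn => //; rewrite inE negb_or => /andP[bx by_].
  by rewrite !fsfun_dflt // mulr0 addr0.
have sD : (finsupp c `<=` D)%fset.
  apply/fsubsetP => b; rewrite mem_finsupp cE; apply: contraR.
  rewrite inE negb_or => /andP[bx by_].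
  by rewrite !fsfun_dflt // mulr0 addr0.
have sumD (V : lmodType R) (g : M -> V) (d : {fsfun M -> R with 0}) :
    (finsupp d `<=` D)%fset ->
    \sum_(b <- finsupp d) d b *: g b = \sum_(b <- D) d b *: g b.
  move=> dD; apply: big_fset_incl => // b _ bd.
  by rewrite fsfun_dflt // scale0r.
have xD : (finsupp (coords x) `<=` D)%fset by rewrite fsubsetUl.
have yD : (finsupp (coords y) `<=` D)%fset by rewrite fsubsetUr.
have sumc (V : lmodType R) (g : M -> V) :
    \sum_(b <- finsupp c) c b *: g b =
      a *: (\sum_(b <- finsupp (coords x)) coords x b *: g b)
      + \sum_(b <- finsupp (coords y)) coords y b *: g b.
  rewrite !sumD // scaler_sumr -big_split /=; apply: eq_bigr => b _.
  by rewrite cE scalerDl scalerA.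
have /coords_uniq ec : expands c (a *: x + y).
  split; last by rewrite sumc -ex -ey.
  move=> b /= /(fsubsetP sD); rewrite inE => /orP[]; first exact: sx.
  exact: sy.
by rewrite /linear_extension ec; exact: (sumc R^o f).
Qed.

End BasisTheory.
End Basis.

Section DualModule.
Variables (A : nzRingType) (P : lmodType A).

Definition dual_module : Type := {linear P -> A^o}.
Identity Coercion dual_module_linear : dual_module >-> GRing.Linear.type.

HB.instance Definition _ := gen_eqMixin dual_module.
HB.instance Definition _ := gen_choiceMixin dual_module.

Implicit Types f g h : dual_module.

Lemma dualP f g : (forall x, f x = g x) -> f = g.
Proof.
case: f g => [f [[fD] [fZ]]] [g [[gD] [gZ]]] /= /funext fg.
subst g; congr (GRing.Linear.Pack (GRing.Linear.Class _ _)).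
  by congr Algebra.isNmodMorphism.Axioms_; exact: Prop_irrelevance.
by congr GRing.isScalable.Axioms_; exact: Prop_irrelevance.
Qed.

Fact dual_zero_subproof : linear_for *:%R ((fun=> 0) : P -> A^o).
Proof. by move=> a x y; rewrite scaler0 addr0. Qed.
Fact dual_opp_subproof f : linear_for *:%R ((fun x => - f x) : P -> A^o).
Proof. by move=> a x y; rewrite linearP opprD scalerN. Qed.
Fact dual_add_subproof f g : linear_for *:%R ((fun x => f x + g x) : P -> A^o).
Proof. by move=> a x y; rewrite !linearP scalerDr addrACA. Qed.
Fact dual_scale_subproof (a : A) f :
  linear_for *:%R ((fun x => (f x : A) * a) : P -> A^o).
Proof. by move=> b x y; rewrite linearP mulrDl; congr (_ + _); exact/esym/mulrA. Qed.

Definition dual_pack (f : P -> A^o) (fL : linear_for *:%R f) : dual_module :=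
  HB.pack_for {linear P -> A^o} f (GRing.isLinear.Build _ _ _ _ f fL).

Definition dual_zero : dual_module := dual_pack dual_zero_subproof.
Definition dual_opp f : dual_module := dual_pack (dual_opp_subproof f).
Definition dual_add f g : dual_module := dual_pack (dual_add_subproof f g).
(* The right action [(f . a) x = f x * a], as a left action of [A^c]. *)
Definition dual_scale (a : A^c) f : dual_module :=
  dual_pack (dual_scale_subproof a f).

Fact dual_addA : associative dual_add.
Proof. by move=> f g h; apply: dualP => x /=; rewrite addrA. Qed.
Fact dual_addC : commutative dual_add.
Proof. by move=> f g; apply: dualP => x /=; rewrite addrC. Qed.
Fact dual_add0 : left_id dual_zero dual_add.
Proof. by move=> f; apply: dualP => x /=; rewrite add0r. Qed.
Fact dual_addN : left_inverse dual_zero dual_opp dual_add.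
Proof. by move=> f; apply: dualP => x /=; rewrite addNr. Qed.

HB.instance Definition _ :=
  GRing.isZmodule.Build dual_module dual_addA dual_addC dual_add0 dual_addN.

Fact dual_scaleA (a b : A^c) f :
  dual_scale a (dual_scale b f) = dual_scale (a * b) f.
Proof. by apply: dualP => x /=; rewrite -mulrA. Qed.
Fact dual_scale1 : left_id 1 dual_scale.
Proof. by move=> f; apply: dualP => x /=; rewrite mulr1. Qed.
Fact dual_scaleDr : right_distributive dual_scale +%R.
Proof. by move=> a f g; apply: dualP => x /=; rewrite mulrDl. Qed.
Fact dual_scaleDl f : {morph dual_scale^~ f : a b / a + b}.
Proof. by move=> a b; apply: dualP => x /=; rewrite mulrDr. Qed.

HB.instance Definition _ := GRing.Zmodule_isLmodule.Build A^c dual_module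
  dual_scaleA dual_scale1 dual_scaleDr dual_scaleDl.

End DualModule.

Section Tensor.
(* A right [A]-module is a left module over the converse ring [A^c]. *)
Variables (A : nzRingType) (M : lmodType A^c) (N : lmodType A).

Definition pure (m : M) (n : N) : {freeg (M * N)%type} := << (m, n) >>.

Inductive tensor_rel : {freeg (M * N)%type} -> Prop :=
| tensor_rel0 : tensor_rel 0
| tensor_relB s t : tensor_rel s -> tensor_rel t -> tensor_rel (s - t)
| tensor_relDl m m' n :
    tensor_rel (pure (m + m') n - pure m n - pure m' n)
| tensor_relDr m n n' :
    tensor_rel (pure m (n + n') - pure m n - pure m n')
| tensor_relZ m (a : A) n :
    tensor_rel (pure ((a : A^c) *: m) n - pure m (a *: n)).

Definition tensor_ker : {pred {freeg (M * N)%type}} :=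
  fun s => `[< tensor_rel s >].

Fact tensor_ker_zmod_closed : zmod_closed tensor_ker.
Proof.
split=> [|s t /asboolP sK /asboolP tK]; apply/asboolP.
  exact: tensor_rel0.
exact: tensor_relB.
Qed.
HB.instance Definition _ :=
  GRing.isZmodClosed.Build _ tensor_ker tensor_ker_zmod_closed.

Definition tensor := Quotient.quot tensor_ker.

Definition tens (m : M) (n : N) : tensor := \pi_tensor (pure m n).

(* [fglift] extends a map on generators to the free abelian group; the result
   is read on a chosen representative, so this is the map induced by [F]
   whenever [F] is additive in each argument and balanced. *)
Definition tensor_lift (V : zmodType) (F : M -> N -> V) (t : tensor) : V :=
  fglift (fun mn => F mn.1 mn.2 : zmodule V) (repr t).

Lemma tensor_lift_tens (V : zmodType) (F : M -> N -> V) :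
  (forall m m' n, F (m + m') n = F m n + F m' n) ->
  (forall m n n', F m (n + n') = F m n + F m n') ->
  (forall m (a : A) n, F ((a : A^c) *: m) n = F m (a *: n)) ->
  zmod_morphism (tensor_lift F) /\
  forall m n, tensor_lift F (tens m n) = F m n.
Proof.
move=> FDl FDr FZ.
pose L := fglift (fun mn => F mn.1 mn.2 : zmodule V) : _ -> V.
have LB : zmod_morphism L := lift_is_additive (M := zmodule V) _.
have L1 m n : L (pure m n) = F m n by rewrite /L liftU /= scale1r.
have LK s : tensor_rel s -> L s = 0.
  elim=> [|{}s t _ Ls _ Lt|m m' n|m n n'|m a n].
  - by have := LB 0 0; rewrite !subrr.
  - by rewrite LB Ls Lt subrr.
  - by rewrite !LB !L1 FDl addrAC addrK subrr.
  - by rewrite !LB !L1 FDr addrAC addrK subrr.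
  - by rewrite LB !L1 FZ subrr.
have Lpi s : tensor_lift F (\pi_tensor s) = L s.
  apply/eqP; rewrite -subr_eq0 -LB; apply/eqP/LK/asboolP.
  have : repr (\pi_tensor s) = s %[mod tensor] by rewrite reprK.
  by move/eqP; rewrite -Quotient.idealrBE.
split=> [t u|m n]; last by rewrite Lpi L1.
rewrite -[t]reprK -[u]reprK.
have -> : \pi_tensor (repr t) - \pi_tensor (repr u) =
  \pi_tensor (repr t - repr u) :> tensor by rewrite !piE.
by rewrite !Lpi LB.
Qed.

End Tensor.

Section TraceQuotient.
Variables (R : comNzRingType) (A : algType R).

Definition commutator_span : {pred A} := fun x =>
  `[< exists s : seq (R * (A * A)),
        x = \sum_(t <- s) t.1 *: (t.2.1 * t.2.2 - t.2.2 * t.2.1) >].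

Fact commutator_span_zmod_closed : zmod_closed commutator_span.
Proof.
split=> [|x y /asboolP[s ->] /asboolP[t ->]]; apply/asboolP.
  by exists [::]; rewrite big_nil.
exists (s ++ [seq (- u.1, u.2) | u <- t]).
rewrite big_cat big_map /=; congr (_ + _).
by rewrite -sumrN; apply: eq_bigr => u _; rewrite scaleNr.
Qed.
HB.instance Definition _ :=
  GRing.isZmodClosed.Build _ commutator_span commutator_span_zmod_closed.

Definition trace_quotient := Quotient.quot commutator_span.

End TraceQuotient.
Arguments trace_quotient {R} A.

Section Modules.
Variables (A : nzRingType).

Definition finitely_generated (P : lmodType A) : Prop :=
  exists s : seq P, forall x : P, exists c : 'I_(size s) -> A,
    x = \sum_i c i *: s`_i.

Definition projective (P : lmodType A) : Prop :=
  forall (M N : lmodType A) (g : {linear M -> N}) (f : {linear P -> N}),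
    (forall y, exists x, g x = y) ->
    exists h : {linear P -> M}, forall x, g (h x) = f x.

(* A resolution [0 -> P_n -> ... -> P_0 -> M -> 0], padded by zero modules. *)
Record fp_resolution (M : lmodType A) := FPResolution {
  res_len : nat;
  res_mod : nat -> lmodType A;
  res_d : forall k, {linear res_mod k.+1 -> res_mod k};
  res_aug : {linear res_mod 0%N -> M};
  res_fg : forall k, finitely_generated (res_mod k);
  res_proj : forall k, projective (res_mod k);
  res_bounded : forall k, (res_len < k)%N -> forall x : res_mod k, x = 0;
  res_aug_surj : forall y, exists x, res_aug x = y;
  res_exact0 : forall x, res_aug x = 0 <-> exists y, res_d 0 y = x;
  res_exactS : forall k x, res_d k x = 0 <-> exists y, res_d k.+1 y = x
}.

Definition type_FP (M : lmodType A) : Prop := inhabited (fp_resolution M).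

End Modules.

Section HattoriStallings.
Variables (R : comNzRingType) (A : algType R).

(* [hs_gamma t] is the endomorphism [gamma_P t]. *)
Definition hs_gamma (P : lmodType A) (t : tensor (dual_module P) P) (x : P) : P :=
  tensor_lift (fun (f : dual_module P) p => (f x : A) *: p) t.

Definition hs_ev (P : lmodType A) (t : tensor (dual_module P) P) :
    trace_quotient A :=
  tensor_lift (fun (f : dual_module P) p => \pi_(trace_quotient A) (f p : A)) t.

Lemma hs_gamma_tens (P : lmodType A) :
  (forall x : P, zmod_morphism (fun t => hs_gamma t x)) /\
  forall (f : dual_module P) p (x : P), hs_gamma (tens f p) x = (f x : A) *: p.
Proof.
have H (x : P) : zmod_morphism (fun t => @hs_gamma P t x) /\
    forall (f : dual_module P) p, hs_gamma (tens f p) x = (f x : A) *: p.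
  apply: tensor_lift_tens => [f g p|f p p'|f a p] /=.
  - exact: scalerDl.
  - exact: scalerDr.
  - by rewrite scalerA.
by split=> [x|f p x]; have [] := H x.
Qed.

Lemma hs_ev_tens (P : lmodType A) :
  zmod_morphism (@hs_ev P) /\
  forall (f : dual_module P) (p : P),
    hs_ev (tens f p) = \pi_(trace_quotient A) (f p : A).
Proof.
apply: tensor_lift_tens => [f g p|f p p'|f a p] /=.
- by rewrite !piE.
- by rewrite linearD !piE.
apply/eqP; rewrite -Quotient.idealrBE; apply/asboolP.
exists [:: (1, ((f p : A), a))]; rewrite big_seq1 /= scale1r.
by rewrite linearZ.
Qed.

(* [ev_P (gamma_P^-1 id)]; [gamma_P] is bijective for [P] finitely generated
   projective, so [xget] then selects the unique preimage of the identity. *)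
Definition hs_rank (P : lmodType A) : trace_quotient A :=
  hs_ev (xget 0 [set t : tensor (dual_module P) P | forall x, hs_gamma t x = x]).

Definition resolution_rank (M : lmodType A) (P : fp_resolution M) :
    trace_quotient A :=
  \sum_(k < (res_len P).+1) hs_rank (res_mod P k) *~ (-1) ^+ k.

(* The rank computed on a finite resolution by finitely generated projectives;
   it does not depend on the resolution. *)
Definition hs_rank_FP (M : lmodType A) : trace_quotient A :=
  xget 0 [set r | exists P : fp_resolution M, resolution_rank P = r].

End HattoriStallings.

Section EulerAlgebra.
Variables (R : comNzRingType) (A : algType R).

Section LambdaModule.
Definition lambda_module (lam : {lrmorphism A -> R^o}) : Type := R.

Variable lam : {lrmorphism A -> R^o}.
HB.instance Definition _ := GRing.Zmodule.copy (lambda_module lam) R.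

Definition lambda_scale (a : A) (r : lambda_module lam) :
    lambda_module lam :=
  (lam a : R) * (r : R).

Fact lambda_scaleA (a b : A) r :
  lambda_scale a (lambda_scale b r) = lambda_scale (a * b) r.
Proof. by rewrite /lambda_scale rmorphM /= mulrA. Qed.
Fact lambda_scale1 : left_id 1 lambda_scale.
Proof. by move=> r; rewrite /lambda_scale rmorph1 mul1r. Qed.
Fact lambda_scaleDr : right_distributive lambda_scale +%R.
Proof. by move=> a r s; rewrite /lambda_scale mulrDr. Qed.
Fact lambda_scaleDl r : {morph lambda_scale^~ r : a b / a + b}.
Proof. by move=> a b; rewrite /lambda_scale raddfD /= mulrDl. Qed.
HB.instance Definition _ := GRing.Zmodule_isLmodule.Build A (lambda_module lam)
  lambda_scaleA lambda_scale1 lambda_scaleDr lambda_scaleDl.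

End LambdaModule.

Variables (B : set A) (lam : {lrmorphism A -> R^o}).

Definition mu_tilde : A -> R := linear_extension B (fun b => (b == 1)%:R).

(* When [mu_tilde] is a trace it vanishes on [commutator_span], and [mu] is the
   induced map. *)
Definition mu (r : trace_quotient A) : R := mu_tilde (repr r).

Lemma mu_tilde_spec : is_basis B -> B 1 ->
  [/\ linear_for *%R mu_tilde, mu_tilde 1 = 1 &
      forall b, B b -> b <> 1 -> mu_tilde b = 0].
Proof.
move=> basisB B1; split; first exact: linear_extension_linear.
  by rewrite /mu_tilde linear_extension_id // eqxx.
by move=> b Bb /eqP b1; rewrite /mu_tilde linear_extension_id // (negPf b1).
Qed.

Definition is_euler_algebra : Prop :=
  [/\ is_basis B, B 1, type_FP (lambda_module lam) &
      forall x y, mu_tilde (x * y) = mu_tilde (y * x)].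

Definition euler_char : R := mu (hs_rank_FP (lambda_module lam)).

End EulerAlgebra.

(* The Hecke algebra is unique up to isomorphism, so it is given here by its
   defining properties. *)
Record hecke_algebra (C : coxeter_system) (R : comNzRingType) (q : R) :=
    HeckeAlgebra {
  hecke_alg :> algType R;
  hecke_T : C -> hecke_alg;
  hecke_T_inj : injective hecke_T;
  hecke_T_basis : is_basis (range hecke_T);
  hecke_T1 : hecke_T 1%g = 1;
  hecke_mulT_up : forall (s : cox_index C) (w : C),
    (cox_length w < cox_length (cox_gen C s * w)%g)%N ->
    hecke_T (cox_gen C s) * hecke_T w = hecke_T (cox_gen C s * w)%g;
  hecke_mulT_down : forall (s : cox_index C) (w : C),
    (cox_length (cox_gen C s * w)%g < cox_length w)%N ->
    hecke_T (cox_gen C s) * hecke_T w =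
      (q - 1) *: hecke_T w + q *: hecke_T (cox_gen C s * w)%g
}.

Section Parity.
Variable C : coxeter_system.
Implicit Types (w : C) (i : cox_index C) (l : seq (cox_index C)).
Local Open Scope group_scope.
Local Notation s := (cox_gen C).

Lemma cox_invol i : s i * s i = 1. Proof. exact: (cox_rel C).1. Qed.

Lemma cox_parity : exists phi : C -> bool, forall l,
  phi (\prod_(i <- l) s i) = odd (size l).
Proof.
pose t : {perm bool} := tperm true false.
have tt1 : t * t = 1 by rewrite tperm2.
have tP : coxeter_relations (@cox_matrix C) (fun=> t).
  by split=> [//|i j _]; rewrite tt1 expg1n.
have [phi phiE] := cox_universal tP.
exists (fun w => odd_perm (phi w)).
have phi1 : phi 1 = 1.
  by apply: (mulgI (phi 1)); rewrite -gmulfM mulg1 mulg1.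
elim=> [|i l IHl]; first by rewrite big_nil phi1 odd_perm1.
by rewrite big_cons gmulfM phiE odd_permM odd_tperm IHl.
Qed.

Lemma cox_length_gen i w :
  cox_length (s i * w) = (cox_length w).+1 \/
  cox_length w = (cox_length (s i * w)).+1.
Proof.
have le v : (cox_length (s i * v) <= (cox_length v).+1)%N.
  have [l <- ->] := cox_lengthP v.
  by have := cox_length_le (i :: l); rewrite big_cons.
have le1 := le w; have := le (s i * w).
rewrite mulgA cox_invol mul1g => le2.
have [phi phiE] := cox_parity.
have phiL v : phi v = odd (cox_length v).
  by have [l <- ->] := cox_lengthP v.
have : phi (s i * w) = ~~ phi w.
  have [l _ ->] := cox_lengthP w.
  by have := phiE (i :: l); rewrite big_cons /= -phiE.
rewrite !phiL => par; case: (ltngtP (cox_length (s i * w)) (cox_length w)).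
- by move=> lt; right; apply/eqP; rewrite eqn_leq le2 lt.
- by move=> lt; left; apply/eqP; rewrite eqn_leq le1 lt.
by move=> eql; move: par; rewrite eql; case: odd.
Qed.

Lemma cox_length_ind (Q : C -> Prop) : Q 1 ->
  (forall i w, (cox_length w < cox_length (s i * w))%N -> Q w -> Q (s i * w)) ->
  forall w, Q w.
Proof.
move=> Q1 QS w; have [n] := ubnP (cox_length w).
elim: n w => // n IHn w; rewrite ltnS => wn.
have [[|i l] lw ew] := cox_lengthP w; first by rewrite ew big_nil.
have e : w = s i * (\prod_(j <- l) s j) by rewrite ew big_cons.
have lt : (cox_length (\prod_(j <- l) s j)%g < cox_length w)%N.
  by rewrite -lw /= ltnS cox_length_le.
rewrite e; apply: QS; first by rewrite -e.
by apply: IHn; apply: leq_trans wn.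
Qed.

End Parity.

Section IndexRepresentation.
Variables (C : coxeter_system) (R : comNzRingType) (q : R).
Variable H : hecke_algebra C q.

Definition hecke_basis : set H := range (@hecke_T C R q H).

Definition index_fun : H -> R^o := linear_extension hecke_basis
  (fun b => q ^+ cox_length (xget (1%g : C) [set w | hecke_T H w = b])).

Lemma index_funT w : index_fun (hecke_T H w) = q ^+ cox_length w.
Proof.
rewrite /index_fun linear_extension_id; [|exact: hecke_T_basis|by exists w].
by case: xgetP => [v _ /hecke_T_inj -> //|/(_ w) []].
Qed.

Lemma index_fun_linear : linear_for *:%R index_fun.
Proof. exact: linear_extension_linear (@hecke_T_basis _ _ _ H) _. Qed.

Let E : {linear H -> R^o} := HB.pack_for {linear H -> R^o} index_fun
  (GRing.isLinear.Build _ _ _ _ index_fun index_fun_linear).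

Lemma hecke_ind (Q : H -> Prop) :
  Q 0 -> (forall a x y, Q x -> Q y -> Q (a *: x + y)) ->
  (forall w, Q (hecke_T H w)) -> forall x, Q x.
Proof.
move=> Q0 QD QT x; have [sx ->] := coordsP (@hecke_T_basis _ _ _ H) x.
rewrite big_seq; elim/big_rec: _ => // b y /sx[w _ <-]; exact: QD.
Qed.

Lemma index_fun_monoid : monoid_morphism (index_fun : H -> R^o).
Proof.
have T1 : E 1 = 1.
  rewrite -(hecke_T1 H) /= index_funT; suff -> : cox_length (1%g : C) = 0%N by [].
  by apply/eqP; rewrite -leqn0; have := @cox_length_le C [::]; rewrite big_nil.
have ET (w : C) : E (hecke_T H w) = q ^+ cox_length w by exact: index_funT.
have EsT i x : E (hecke_T H (cox_gen C i) * x) = q * E x.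
  elim/hecke_ind: x => [|a x y Ex Ey|w]; first by rewrite mulr0 linear0 mulr0.
    rewrite mulrDr -scalerAr linearP linearP Ex Ey mulrDr; congr (_ + _).
    exact: mulrCA.
  have [up|down] := cox_length_gen i w.
    by rewrite hecke_mulT_up ?up// !ET up exprS.
  rewrite hecke_mulT_down ?down// linearP linearZ /= !index_funT.
  rewrite down exprS /GRing.scale /=; set z := q ^+ _.
  by rewrite mulrBl mul1r subrK.
split; first exact: T1.
suff ETw (w : C) y : E (hecke_T H w * y) = E (hecke_T H w) * E y.
  move=> x y; change (E (x * y) = E x * E y).
  elim/hecke_ind: x => [|a x z Ex Ez|w]; last exact: ETw.
    by rewrite mul0r linear0 mul0r.
  rewrite mulrDl -scalerAl linearP linearP Ex Ez mulrDl; congr (_ + _).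
  exact: mulrA.
elim/cox_length_ind: w y => [|i w lt IHw] y.
  by rewrite hecke_T1 T1 !mul1r.
by rewrite -hecke_mulT_up // -mulrA !EsT IHw mulrA.
Qed.

Definition index_rep : {lrmorphism H -> R^o} :=
  HB.pack_for {lrmorphism H -> R^o} index_fun
    (GRing.isLinear.Build _ _ _ _ index_fun index_fun_linear)
    (GRing.isMonoidMorphism.Build _ _ index_fun index_fun_monoid).

Lemma index_repT w : index_rep (hecke_T H w) = q ^+ cox_length w.
Proof. exact: index_funT. Qed.

End IndexRepresentation.

Arguments hecke_basis {C R q} H.
Arguments index_rep {C R q} H.

(* Main.v *)
(* For a set K of generators let N_K be the left ideal of those h with
   h T_s = - h for all s in K. The resolution of the index module has the sum of
   the N_K with #|K| = k in degree k, starting at N_set0 = H, with the simplicial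
   (Koszul) differential. It is exact because the longest terms T_w of an element
   of N_K satisfy K \subset D(w), where D(w) is the right descent set, and each w
   is the leading term of an element of N_(D(w)): on leading terms the complex
   splits into simplices on the sets D(w), and D(w) is empty only for w = 1.
   If no D(w) contains K then N_K = 0. Otherwise the parabolic subgroup W_K is
   finite and N_K = H e_K for an idempotent e_K supported on W_K, and counting
   along the cosets of W_K gives
     p(q) mu(e_K) = \sum_(w | K \subset D(w)) q ^ l(w).
   Hence p(q) chi = \sum_w q ^ l(w) \sum_(K \subset D(w)) (-1) ^ #|K| = 1.
   Since [hs_rank_FP] refers to an unspecified resolution, the rank is compared
   along chain maps that are inverse up to homotopy, traces being cyclic.
   The exchange condition is read off the associativity of H. *)
Require Import Defs.
From HB Require Import structures.
From mathcomp Require Import all_boot all_order all_algebra.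
From mathcomp Require Import fingroup finmap all_classical.
From mathcomp Require Import generic_quotient ring_quotient freeg zify ring.

Set Implicit Arguments.
Unset Strict Implicit.
Unset Printing Implicit Defensive.

Import GRing.Theory.
Local Open Scope quotient_scope.
Local Open Scope classical_set_scope.
Local Open Scope ring_scope.

(** * Traces on finitely generated projective modules *)

Section TensorSum.
Variables (A : nzRingType) (M : lmodType A^c) (N : lmodType A).

Lemma tens_eq (s t : {freeg (M * N)%type}) :
  tensor_rel (s - t) -> \pi_(tensor M N) s = \pi_(tensor M N) t.
Proof. by move=> st; apply/eqP; rewrite -Quotient.idealrBE; apply/asboolP. Qed.

Lemma tensDl (m m' : M) (n : N) : tens (m + m') n = tens m n + tens m' n.
Proof.
rewrite /tens !piE; apply: tens_eq; rewrite opprD addrA.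
exact: tensor_relDl.
Qed.

Lemma tensZ (m : M) (n : N) (k : int) :
  \pi_(tensor M N) << k *g (m, n) >> = tens (m *~ k) n.
Proof.
have tB : zmod_morphism (fun m : M => tens m n).
  by move=> x y /=; apply: (@addIr _ (tens y n)); rewrite -tensDl !subrK.
pose f : {additive M -> tensor M N} := HB.pack_for {additive M -> tensor M N}
  (fun m => tens m n) (GRing.isZmodMorphism.Build _ _ _ tB).
pose pi := \pi_(tensor M N) : {freeg (M * N)%type} -> tensor M N.
have pB : zmod_morphism pi by move=> x y; rewrite /pi !piE.
pose g : {additive {freeg (M * N)%type} -> tensor M N} :=
  HB.pack_for {additive {freeg (M * N)%type} -> tensor M N} pi
  (GRing.isZmodMorphism.Build _ _ _ pB).
have -> : << k *g (m, n) >> = (<< (m, n) >> : {freeg (M * N)%type}) *~ k.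
  by rewrite freegU_mulz intz.
change (g (<< (m, n) >> *~ k) = f (m *~ k)).
by rewrite !raddfMz.
Qed.

(** Integer coefficients are absorbed into the left factor, so an arbitrary preimage of the identity
    under [hs_gamma] can be read as a finite list of pairs. *)
Lemma tensor_sum (t : tensor M N) :
  exists s : seq (M * N), t = \sum_(z <- s) tens z.1 z.2.
Proof.
rewrite -[t]reprK -[repr t]Freeg_dom.
elim: [seq _ | _ <- _] => [|[k [m n]] l [s IHs]].
  exists [::]; rewrite big_nil freeg_nil; exact: (raddf0 (\pi_(tensor M N))).
exists ((m *~ k, n) :: s); rewrite big_cons -IHs /= -tensZ -[_ :: l]cat1s freeg_cat.
exact: (raddfD (\pi_(tensor M N))).
Qed.

End TensorSum.

Section DualBasis.
Variables (A : nzRingType).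

(** Such lists represent the identity in the tensor product; by the dual basis lemma they exist
    exactly for finitely generated projective [P]. *)
Definition dual_basis (P : lmodType A) (s : seq (dual_module P * P)) :=
  forall x, x = \sum_(z <- s) (z.1 x : A) *: z.2.

End DualBasis.

Section Rank.
Variables (R : comNzRingType) (A : algType R).

(** The list [s] ensures that a preimage of the identity exists; which one [xget] selects is
    unknown, hence a new list [s']. *)
Lemma hs_rank_dual_basis (P : lmodType A) (s : seq (dual_module P * P)) :
  dual_basis s -> exists2 s' : seq (dual_module P * P), dual_basis s' &
    hs_rank P = \sum_(z <- s') \pi_(trace_quotient A) (z.1 z.2 : A).
Proof.
move=> sP; have [gB gt] := @hs_gamma_tens R A P.
have [eB et] := @hs_ev_tens R A P.
pose ev : {additive tensor (dual_module P) P -> trace_quotient A} :=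
  HB.pack_for {additive tensor (dual_module P) P -> trace_quotient A} (@hs_ev R A P)
  (GRing.isZmodMorphism.Build _ _ _ eB).
pose ga x : {additive tensor (dual_module P) P -> P} :=
  HB.pack_for {additive tensor (dual_module P) P -> P} (fun t => hs_gamma t x)
  (GRing.isZmodMorphism.Build _ _ _ (gB x)).
have gaE (s' : seq (dual_module P * P)) x :
    hs_gamma (\sum_(z <- s') tens z.1 z.2) x = \sum_(z <- s') (z.1 x : A) *: z.2.
  rewrite -[LHS]/(ga x _) raddf_sum; apply: eq_bigr => z _.
  exact: gt.
rewrite /hs_rank; case: xgetP => [t _ /= tP|/(_ (\sum_(z <- s) tens z.1 z.2))[]].
  have [s' ts'] := tensor_sum t; exists s'.
    by move=> x; rewrite -gaE -ts' tP.
  rewrite ts' -[LHS]/(ev _) raddf_sum; apply: eq_bigr => z _.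
  exact: et.
by move=> x /=; rewrite gaE -sP.
Qed.

End Rank.

Section Trace.
Variables (R : comNzRingType) (A : algType R) (tau : {additive A -> R}).
Hypothesis tauC : forall x y, tau (x * y) = tau (y * x).

Definition mod_trace (P : lmodType A) (s : seq (dual_module P * P)) (f : P -> P) : R :=
  \sum_(z <- s) tau (z.1 (f z.2) : A).

(** Expanding [f z.2] along [t] and [g y.2] along [s] gives the same double sum, up to the order of
    the two factors inside [tau]. When [f] and [g] are identities this is independence of the dual
    basis. *)
Lemma mod_traceC (P Q : lmodType A) (s : seq (dual_module P * P))
    (t : seq (dual_module Q * Q)) (f : {linear P -> Q}) (g : {linear Q -> P}) :
  dual_basis s -> dual_basis t ->
  mod_trace s (g \o f) = mod_trace t (f \o g).
Proof.
move=> sP tQ; rewrite /mod_trace.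
transitivity (\sum_(z <- s) \sum_(y <- t)
    tau ((y.1 (f z.2) : A) * (z.1 (g y.2) : A))).
  apply: eq_bigr => z _ /=; rewrite -raddf_sum; congr (tau _).
  rewrite [f z.2 in LHS]tQ !linear_sum; apply: eq_bigr => y _.
  by rewrite !linearZ.
rewrite exchange_big; apply: eq_bigr => y _ /=.
rewrite [g y.2 in RHS]sP !linear_sum /=.
rewrite raddf_sum; apply: eq_bigr => z _.
by rewrite !linearZ /= tauC.
Qed.

End Trace.

Definition linear_pack (A : nzRingType) (M N : lmodType A) (f : M -> N)
    (fL : linear_for *:%R f) : {linear M -> N} :=
  HB.pack_for {linear M -> N} f (GRing.isLinear.Build _ _ _ _ f fL).

Section Projective.
Variable A : nzRingType.
Implicit Types P M N : lmodType A.

Section Free.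
Variable T : finType.
Notation F := {ffun T -> A^o}.

Definition ffun_delta (t : T) : F := [ffun u => (u == t)%:R : A].

Lemma ffun_sum_delta (f : F) : f = \sum_t (f t : A) *: ffun_delta t.
Proof.
apply/ffunP => u; rewrite sum_ffunE (bigD1 u) //= big1 => [|t tu]; rewrite !ffunE.
  by rewrite eqxx addr0 /GRing.scale /= mulr1.
by rewrite eq_sym (negPf tu) /GRing.scale /= mulr0.
Qed.

Variable P : lmodType A.

Fact ffun_comb_subproof (x : T -> P) :
  linear_for *:%R (fun f : F => \sum_t (f t : A) *: x t).
Proof.
move=> a f g; rewrite scaler_sumr -big_split /=; apply: eq_bigr => t _.
by rewrite !ffunE scalerDl scalerA.
Qed.

Variables (i : {linear P -> F}) (p : {linear F -> P}).

Fact coord_subproof (t : T) : linear_for *:%R (fun x : P => i x t).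
Proof. by move=> a x y; rewrite linearP !ffunE. Qed.

Definition retract_basis : seq (dual_module P * P) :=
  [seq (dual_pack (coord_subproof t), p (ffun_delta t)) | t <- enum T].

(** Serves both for abstract projective modules, as summands of free ones, and for the explicit
    modules of the resolution. *)
Lemma retract_dual_basis : cancel i p -> dual_basis retract_basis.
Proof.
move=> ipK x; rewrite big_map big_enum /= -{1}[x]ipK [i x in LHS]ffun_sum_delta.
by rewrite linear_sum; apply: eq_bigr => t _; rewrite linearZ.
Qed.

End Free.

(** Lifting the identity through the surjection from a finite free module makes [P] a retract of
    it. *)
Lemma fg_proj_dual_basis P : finitely_generated P -> projective P ->
  exists s : seq (dual_module P * P), dual_basis s.
Proof.
move=> [s sP] pP.
pose p : {linear {ffun 'I_(size s) -> A^o} -> P} :=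
  linear_pack (ffun_comb_subproof (fun i : 'I_(size s) => s`_i)).
have psurj y : exists x, p x = y.
  have [c ->] := sP y; exists [ffun i => c i].
  by rewrite /p /=; apply: eq_bigr => i _; rewrite ffunE.
have [i ipK] := pP _ _ p (linear_pack (f := @id P) (fun _ _ _ => erefl)) psurj.
exists (retract_basis i p); exact: retract_dual_basis.
Qed.

(** Asking only that the values of [f] lie in the image of [g] allows lifts of maps into cycles
    without forming the submodule of boundaries. *)
Lemma dual_basis_lift P M N (s : seq (dual_module P * P))
    (g : {linear M -> N}) (f : {linear P -> N}) :
  dual_basis s -> (forall x, exists y, g y = f x) ->
  exists h : {linear P -> M}, forall x, g (h x) = f x.
Proof.
move=> sP fg; have [k kE] := choice fg.
have hL : linear_for *:%R (fun x => \sum_(z <- s) (z.1 x : A) *: k z.2).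
  move=> a x y; rewrite scaler_sumr -big_split /=; apply: eq_bigr => z _.
  by rewrite linearP scalerDl scalerA.
exists (linear_pack hL) => x; rewrite [x in RHS]sP !linear_sum.
by apply: eq_bigr => z _; rewrite !linearZ /= kE.
Qed.

Lemma dual_basis_fg P (s : seq (dual_module P * P)) :
  dual_basis s -> finitely_generated P.
Proof.
move=> sP; exists (unzip2 s) => x.
(* [nth] wants a default pair; the head of the list supplies it, and the empty list is treated
   apart. *)
pose c i := if s is z0 :: _ then (nth z0 s i).1 x : A else 0.
exists (fun i => c i).
rewrite -(big_mkord xpredT (fun i => c i *: (unzip2 s)`_i)) size_map {1}[x]sP /c.
case: s {sP c} => [|z0 s]; first by rewrite big_nil big_geq.
rewrite (big_nth z0) !big_nat; apply: eq_bigr => i /andP[_ ilt].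
by rewrite (nth_map z0).
Qed.

Lemma dual_basis_projective P (s : seq (dual_module P * P)) :
  dual_basis s -> projective P.
Proof. by move=> sP M N g f gs; apply: dual_basis_lift sP _ => x; exact: gs. Qed.

End Projective.

(** * Comparison of projective resolutions *)

Section Comparison.
Variables (A : nzRingType) (M : lmodType A).
Implicit Types P Q : fp_resolution M.

(** Treats the augmentation as the differential leaving degree 0, so that exactness is one statement
    in all degrees. *)
Definition res_cycle P k : res_mod P k -> Prop :=
  match k return res_mod P k -> Prop with
  | 0 => fun x => res_aug P x = 0
  | j.+1 => fun x => res_d P j x = 0
  end.

Lemma res_exact P k x : res_cycle (k := k) x <-> exists y, res_d P k y = x.
Proof. by case: k x => [|k] x; [exact: res_exact0 | exact: res_exactS]. Qed.

Lemma res_d_cycle P k y : res_cycle (res_d P k y).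
Proof. by apply/res_exact; exists y. Qed.

Lemma res_dual_basis P k : exists s, dual_basis (P := res_mod P k) s.
Proof. exact: fg_proj_dual_basis (@res_fg _ _ P k) (@res_proj _ _ P k). Qed.

Lemma chain_map P Q : exists f : forall k, {linear res_mod P k -> res_mod Q k},
  (forall x, res_aug Q (f 0%N x) = res_aug P x) /\
  (forall k x, res_d Q k (f k.+1 x) = f k (res_d P k x)).
Proof.
(* The recursion must carry this property along: it is what makes the next lift possible. *)
pose good k (f : {linear res_mod P k -> res_mod Q k}) :=
  forall x, res_cycle x -> res_cycle (f x).
have [s0 s0P] := res_dual_basis P 0.
have [f0 f0E] : exists f0 : {linear res_mod P 0 -> res_mod Q 0},
    forall x, res_aug Q (f0 x) = res_aug P x.
  apply: (dual_basis_lift s0P) => x; exact: res_aug_surj.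
have f0g : good 0%N f0 by move=> x; rewrite /= f0E.
have step k (f : {f | @good k f}) : exists g : {g | @good k.+1 g},
    forall x, res_d Q k (sval g x) = sval f (res_d P k x).
  case: f => f fg; have [s sP] := res_dual_basis P k.+1.
  have [g gE] : exists g : {linear res_mod P k.+1 -> res_mod Q k.+1},
      forall x, res_d Q k (g x) = (f \o res_d P k) x.
    apply: (dual_basis_lift sP) => x /=; apply/res_exact/fg.
    exact: res_d_cycle.
  have gg : good k.+1 g by move=> x; rewrite /= gE /= => ->; rewrite linear0.
  by exists (exist _ g gg).
pose F := nat_rect (fun k => {f | @good k f}) (exist _ f0 f0g)
  (fun k f => projT1 (cid (step k f))).
exists (fun k => sval (F k)); split=> [x|k x]; first exact: f0E.
by rewrite /=; case: cid => g /= ->.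
Qed.

Lemma null_homotopy P (f : forall k, {linear res_mod P k -> res_mod P k}) :
  (forall x, res_aug P (f 0%N x) = 0) ->
  (forall k x, res_d P k (f k.+1 x) = f k (res_d P k x)) ->
  exists h : forall k, {linear res_mod P k -> res_mod P k.+1},
    (forall x, f 0%N x = res_d P 0 (h 0%N x)) /\
    (forall k x, f k.+1 x = res_d P k.+1 (h k.+1 x) + h k (res_d P k x)).
Proof.
move=> f0 fd.
(* This makes [f k.+1 x - h (res_d P k x)] a cycle, so that it lifts along the next differential. *)
pose good k (h : {linear res_mod P k -> res_mod P k.+1}) :=
  forall y, res_d P k (h (res_d P k y)) = f k (res_d P k y).
have [s0 s0P] := res_dual_basis P 0.
have [h0 h0E] : exists h0 : {linear res_mod P 0 -> res_mod P 1},
    forall x, res_d P 0 (h0 x) = f 0%N x.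
  by apply: (dual_basis_lift s0P) => x; apply/res_exact; exact: f0.
have h0g : good 0%N h0 by move=> y; rewrite h0E.
have step k (h : {h | @good k h}) : exists g : {g | @good k.+1 g},
    forall x, f k.+1 x = res_d P k.+1 (sval g x) + sval h (res_d P k x).
  case: h => h hg; have [s sP] := res_dual_basis P k.+1.
  have uL : linear_for *:%R (fun x => f k.+1 x - h (res_d P k x)).
    by move=> a x y; rewrite !linearP scalerDr addrACA.
  have [g gE] : exists g : {linear res_mod P k.+1 -> res_mod P k.+2},
      forall x, res_d P k.+1 (g x) = linear_pack uL x.
    apply: (dual_basis_lift sP) => x; apply/res_exact => /=.
    by rewrite linearB fd hg subrr.
  have gg : good k.+1 g.
    move=> y; rewrite gE /=.
    have -> : res_d P k (res_d P k.+1 y) = 0 by exact: (@res_d_cycle P k.+1 y).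
    by rewrite linear0 subr0.
  by exists (exist _ g gg) => x /=; rewrite gE /= subrK.
pose F := nat_rect (fun k => {f | @good k f}) (exist _ h0 h0g)
  (fun k f => projT1 (cid (step k f))).
exists (fun k => sval (F k)); split=> [x|k x]; first by rewrite /= h0E.
by rewrite /=; case: cid => g /= ->.
Qed.

End Comparison.

(** * Alternating sums of traces and their homotopy invariance *)

Section EulerTrace.
Variables (R : comNzRingType) (A : algType R) (tau : {additive A -> R}).
Hypothesis tauC : forall x y, tau (x * y) = tau (y * x).
Variable M : lmodType A.
Implicit Types P Q : fp_resolution M.

(** The number [N] of terms is left free so that resolutions of different lengths can be summed up
    to a common bound. *)
Definition euler_trace P (s : forall k, seq (dual_module (res_mod P k) * res_mod P k))
    N (f : forall k, res_mod P k -> res_mod P k) : R :=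
  \sum_(k < N) (-1) ^+ k * mod_trace tau (s k) (f k).

Lemma mod_traceD (P : lmodType A) (s : seq (dual_module P * P)) (f g : P -> P) :
  mod_trace tau s (fun x => f x + g x) = mod_trace tau s f + mod_trace tau s g.
Proof.
rewrite -big_split; apply: eq_bigr => z _ /=.
by rewrite linearD raddfD.
Qed.

Lemma eq_mod_trace (P : lmodType A) (s : seq (dual_module P * P)) (f g : P -> P) :
  f =1 g -> mod_trace tau s f = mod_trace tau s g.
Proof. by move=> fg; apply: eq_bigr => z _; rewrite fg. Qed.

Lemma mod_trace0 (P : lmodType A) (s : seq (dual_module P * P)) (f : P -> P) :
  (forall x : P, x = 0) -> mod_trace tau s f = 0.
Proof.
by move=> P0; rewrite /mod_trace big1 // => z _; rewrite [f _]P0 linear0 raddf0.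
Qed.

Lemma euler_trace_homotopy P s N (f : forall k, {linear res_mod P k -> res_mod P k}) :
  (forall k, dual_basis (s k)) -> (res_len P <= N)%N ->
  (forall x, res_aug P (f 0%N x) = 0) ->
  (forall k x, res_d P k (f k.+1 x) = f k (res_d P k x)) ->
  euler_trace s N.+1 (fun k => f k) = 0.
Proof.
move=> sP PN f0 fd; have [h [h0 hS]] := null_homotopy f0 fd.
pose t k := mod_trace tau (s k) (res_d P k \o h k).
(* The sum telescopes: by cyclicity the trace of [h n \o res_d P n] in degree [n.+1] cancels that of
   [res_d P n \o h n] in degree [n]. *)
have E n : euler_trace s n.+1 (fun k => f k) = (-1) ^+ n * t n.
  rewrite /euler_trace; elim: n => [|n IHn].
    by rewrite big_ord1; congr (_ * _); apply: eq_mod_trace => x /=; rewrite h0.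
  rewrite big_ord_recr /= IHn.
  rewrite (eq_mod_trace _ (hS n)) mod_traceD.
  have -> : mod_trace tau (s n.+1) (fun x => h n (res_d P n x)) = t n.
    exact: (mod_traceC tauC (res_d P n) (h n) (sP n.+1) (sP n)).
  by rewrite mulrDr exprS !mulN1r !mulNr addrC -addrA addNr addr0.
(* Cyclicity moves the one remaining trace to degree [N.+1], where the module is zero. *)
rewrite E /t (mod_traceC tauC (h N) (res_d P N) (sP N) (sP N.+1)).
by rewrite mod_trace0 ?mulr0 //; exact: res_bounded.
Qed.

Lemma euler_trace_widen P s N f : (res_len P <= N)%N ->
  euler_trace (P := P) s N.+1 f = euler_trace s (res_len P).+1 f.
Proof.
move=> PN; rewrite /euler_trace 
  -!(big_mkord xpredT (fun k => (-1) ^+ k * mod_trace tau (s k) (f k))).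
rewrite (big_cat_nat _ (n := (res_len P).+1)) //= [X in _ + X]big1_seq ?addr0 //.
move=> k /andP[_]; rewrite mem_index_iota => /andP[Pk _].
by rewrite mod_trace0 ?mulr0 //; exact: res_bounded.
Qed.

(** The identity of [P] is homotopic to [g \o f] and that of [Q] to [f \o g]; these composites have
    equal traces in each degree. *)
Lemma euler_trace_invariant P Q s t :
  (forall k, dual_basis (s k)) -> (forall k, dual_basis (t k)) ->
  euler_trace (P := P) s (res_len P).+1 (fun k x => x) =
  euler_trace (P := Q) t (res_len Q).+1 (fun k x => x).
Proof.
move=> sP tQ; pose N := maxn (res_len P) (res_len Q).
have [f [f0 fd]] := chain_map P Q; have [g [g0 gd]] := chain_map Q P.
have id_comp P' Q' s' (f' : forall k, {linear res_mod P' k -> res_mod Q' k})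
    (g' : forall k, {linear res_mod Q' k -> res_mod P' k}) :
    (forall k, dual_basis (s' k)) -> (res_len P' <= N)%N ->
    (forall x, res_aug Q' (f' 0%N x) = res_aug P' x) ->
    (forall k x, res_d Q' k (f' k.+1 x) = f' k (res_d P' k x)) ->
    (forall x, res_aug P' (g' 0%N x) = res_aug Q' x) ->
    (forall k x, res_d P' k (g' k.+1 x) = g' k (res_d Q' k x)) ->
    euler_trace (P := P') s' N.+1 (fun k x => x) =
    euler_trace s' N.+1 (fun k => g' k \o f' k).
  move=> sP' P'N f0' fd' g0' gd'.
  have uL k : linear_for *:%R (fun x : res_mod P' k => x - g' k (f' k x)).
    by move=> a x y; rewrite !linearP scalerDr addrACA.
  have /esym e : euler_trace s' N.+1 (fun k => linear_pack (uL k)) = 0.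
    apply: euler_trace_homotopy => //= [x|k x].
      by rewrite linearB g0' f0' subrr.
    by rewrite linearB gd' fd'.
  rewrite -[RHS]add0r [X in X + _]e /euler_trace -big_split; apply: eq_bigr => k _ /=.
  rewrite -mulrDr -mod_traceD; congr (_ * _).
  by apply: eq_mod_trace => x /=; rewrite subrK.
rewrite -(euler_trace_widen _ _ (leq_maxl _ (res_len Q))).
rewrite -(@euler_trace_widen Q _ _ _ (leq_maxr (res_len P) _)).
rewrite (id_comp P Q s f g) ?leq_maxl // (id_comp Q P t g f) ?leq_maxr //.
by apply: eq_bigr => k _; congr (_ * _); exact: mod_traceC.
Qed.

End EulerTrace.

Section EulerChar.
Variables (R : comNzRingType) (A : algType R) (B : set A) (lam : {lrmorphism A -> R^o}).
Hypothesis basisB : is_basis B.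
Hypothesis muC : forall x y, mu_tilde B (x * y) = mu_tilde B (y * x).

Definition mu_tilde_linear : {linear A -> R | *%R} :=
  HB.pack_for {linear A -> R | *%R} (mu_tilde B)
    (GRing.isLinear.Build _ _ _ _ (mu_tilde B) (linear_extension_linear basisB _)).

(** The chosen representative differs from [x] by a combination of commutators, on which [mu_tilde]
    vanishes. *)
Lemma mu_pi x : mu B (\pi_(trace_quotient A) x) = mu_tilde B x.
Proof.
have : repr (\pi_(trace_quotient A) x) = x %[mod trace_quotient A] by rewrite reprK.
move/eqP; rewrite -Quotient.idealrBE => /asboolP[s es].
apply/eqP; rewrite -subr_eq0; apply/eqP.
transitivity (mu_tilde_linear (repr (\pi_(trace_quotient A) x) - x)).
  by rewrite linearB.
rewrite es linear_sum big1 // => t _.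
by rewrite linearZ linearB /= muC subrr mulr0.
Qed.

Lemma mu_additive : zmod_morphism (mu B).
Proof.
move=> x y; rewrite -[x]reprK -[y]reprK.
have -> : \pi_(trace_quotient A) (repr x) - \pi_(trace_quotient A) (repr y) =
  \pi_(trace_quotient A) (repr x - repr y) :> trace_quotient A by rewrite !piE.
by rewrite !mu_pi -[LHS]/(mu_tilde_linear _) raddfB.
Qed.

(** The definition picks an unknown resolution and, on it, unknown preimages of the identities.
    [euler_trace_invariant] covers both choices, so a convenient [Q] and [t] may be used instead. *)
Lemma euler_char_resolution (Q : fp_resolution (lambda_module lam)) t :
  (forall k, dual_basis (t k)) ->
  euler_char B lam =
    euler_trace (P := Q) mu_tilde_linear t (res_len Q).+1 (fun k x => x).
Proof.
move=> tQ; rewrite /euler_char /hs_rank_FP.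
case: xgetP => [r _ /= [P Pr]|/(_ (resolution_rank Q))[]]; last by exists Q.
pose m : {additive trace_quotient A -> R} :=
  HB.pack_for {additive trace_quotient A -> R} (mu B)
  (GRing.isZmodMorphism.Build _ _ _ mu_additive).
have db k : exists s : seq (dual_module (res_mod P k) * res_mod P k),
    dual_basis s /\
    hs_rank (res_mod P k) = \sum_(z <- s) \pi_(trace_quotient A) (z.1 z.2 : A).
  have [s0 s0P] := res_dual_basis P k.
  by have [s sP rE] := hs_rank_dual_basis s0P; exists s.
pose s k := projT1 (cid (db k)).
have sP k : dual_basis (s k) by rewrite /s; case: cid => ? [].
have sr k : hs_rank (res_mod P k) = \sum_(z <- s k) \pi_(trace_quotient A) (z.1 z.2 : A).
  by rewrite /s; case: cid => ? [].
rewrite -[RHS](@euler_trace_invariant _ _ mu_tilde_linear muC _ P Q s t sP tQ).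
rewrite -Pr -[LHS]/(m _) raddf_sum.
apply: eq_bigr => k _; rewrite raddfMz sr raddf_sum -mulrzr mulrC; congr (_ * _).
  by rewrite rmorphXn /= mulrN1z.
by apply: eq_bigr => z _; exact: mu_pi.
Qed.

End EulerChar.

(** * Length and right multiplication *)

Section LengthTheory.
Variable C : coxeter_system.
Implicit Types (w u v : C) (i : cox_index C) (l : seq (cox_index C)).
Local Open Scope group_scope.
Local Notation s := (cox_gen C).
Local Notation ell := (@cox_length C).

(* [mulgA] and [invgM] at the group instance used by [coxeter_system], so that
   [lia] recognizes the resulting products. *)
Lemma cox_mulA u v w : u * (v * w) = u * v * w.
Proof. exact: mulgA. Qed.

Lemma cox_invM u v : (u * v)^-1 = v^-1 * u^-1.
Proof. exact: invgM. Qed.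

Definition cox_prod l : C := \prod_(i <- l) s i.

Lemma cox_prod_nil : cox_prod [::] = 1.
Proof. exact: big_nil. Qed.

Lemma cox_prod_cons i l : cox_prod (i :: l) = s i * cox_prod l.
Proof. exact: big_cons. Qed.

Lemma cox_prod_cat k l : cox_prod (k ++ l) = cox_prod k * cox_prod l.
Proof. exact: big_cat. Qed.

Lemma cox_prod_rcons i l : cox_prod (rcons l i) = cox_prod l * s i.
Proof. by rewrite -cats1 cox_prod_cat /cox_prod big_seq1. Qed.

Lemma cox_length_prod l : (ell (cox_prod l) <= size l)%N.
Proof. exact: cox_length_le. Qed.

Lemma cox_reduced_word w : exists2 l, size l = ell w & w = cox_prod l.
Proof. exact: cox_lengthP. Qed.

Lemma cox_length1 : ell 1 = 0%N.
Proof. by apply/eqP; rewrite -leqn0; have := @cox_length_le C [::]; rewrite big_nil. Qed.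

Lemma cox_length_eq0 w : ell w = 0%N -> w = 1.
Proof. by move=> w0; have [[|i l] lw ->] := cox_lengthP w; rewrite ?big_nil // -lw in w0 *. Qed.

Lemma cox_genV i : (s i)^-1 = s i.
Proof. by apply: (mulgI (s i)); rewrite mulgV cox_invol. Qed.

Lemma cox_prodV l : (cox_prod l)^-1 = cox_prod (rev l).
Proof.
elim: l => [|i l IHl]; first by rewrite cox_prod_nil invg1.
by rewrite cox_prod_cons rev_cons cox_prod_rcons -IHl cox_invM cox_genV.
Qed.

Lemma cox_lengthV w : ell w^-1 = ell w.
Proof.
have le v : (ell v^-1 <= ell v)%N.
  have [l <- {1}->] := cox_reduced_word v.
  by rewrite cox_prodV -(size_rev l) cox_length_prod.
by apply/eqP; rewrite eqn_leq le /=; have := le w^-1; rewrite invgK.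
Qed.

Lemma cox_lengthM u v : (ell (u * v) <= ell u + ell v)%N.
Proof.
have [l <- {1}->] := cox_reduced_word u; have [k <- {1}->] := cox_reduced_word v.
by rewrite -cox_prod_cat -size_cat cox_length_prod.
Qed.

Lemma cox_length_s i : ell (s i) = 1%N.
Proof. by have := cox_length_gen i 1; rewrite mulg1 cox_length1; lia. Qed.

Lemma cox_length_genr i w :
  ell (w * s i) = (ell w).+1 \/ ell w = (ell (w * s i)).+1.
Proof.
have := cox_length_gen i w^-1.
by rewrite -[s i * _]invgK cox_invM invgK cox_genV !cox_lengthV.
Qed.

Lemma cox_mulsK i w : w * s i * s i = w.
Proof. by rewrite -cox_mulA cox_invol mulg1. Qed.

Lemma cox_smulK i w : s i * (s i * w) = w.
Proof. by rewrite cox_mulA cox_invol mul1g. Qed.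

End LengthTheory.

(** * Coefficients in the standard basis, the trace and the exchange condition *)

Section Coef.
Variables (C : coxeter_system) (R : comNzRingType) (q : R) (H : hecke_algebra C q).
Implicit Types (w u v : C) (i : cox_index C) (x y : H).
Local Notation s := (cox_gen C).
Local Notation ell := (@cox_length C).
Local Notation T := (hecke_T H).
Local Notation B := (hecke_basis H).

Definition coef u : H -> R := linear_extension B (fun b => (b == T u)%:R).

HB.instance Definition _ u := GRing.isLinear.Build R H R *%R (coef u)
  (linear_extension_linear (@hecke_T_basis _ _ _ H) _).

Lemma coef_T u w : coef u (T w) = (w == u)%:R.
Proof.
rewrite [LHS]linear_extension_id; [|exact: hecke_T_basis|by exists w].
by rewrite (inj_eq (@hecke_T_inj _ _ _ H)).
Qed.

Lemma mu_tilde_coef x : mu_tilde B x = coef 1%g x.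
Proof. by rewrite /mu_tilde -(hecke_T1 H). Qed.

Lemma coef_eq0 x : (forall u, coef u x = 0) -> x = 0.
Proof.
move=> x0; have [sx ex] := coordsP (@hecke_T_basis _ _ _ H) x.
rewrite ex big_seq big1 // => b bx; have [u _ eb] := sx _ bx.
have := x0 u; rewrite /coef /linear_extension (big_fsetD1 b) //= eb eqxx mulr1.
rewrite big1_fset ?addr0; first by move->; rewrite scale0r.
by move=> c; rewrite !inE => /andP[/negPf -> _]; rewrite mulr0.
Qed.

Lemma coefP x y : (forall u, coef u x = coef u y) -> x = y.
Proof.
move=> xy; apply/eqP; rewrite -subr_eq0; apply/eqP/coef_eq0 => u.
by rewrite linearB /= xy subrr.
Qed.

(** Finite support, put as a bound on length: this bound drives the inductions on leading terms. *)
Lemma coef_bounded x : exists n, forall u, (n <= ell u)%N -> coef u x = 0.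
Proof.
elim/hecke_ind: x => [|a x y [n xn] [m ym]|w].
- by exists 0%N => u _; rewrite linear0.
- exists (maxn n m) => u; rewrite geq_max => /andP[/xn xu /ym yu].
  by rewrite linearP /= xu yu mulr0 addr0.
exists (ell w).+1 => u; rewrite coef_T.
by case: eqP => // <-; rewrite ltnn.
Qed.

Lemma hecke_coef_sum (X : {fset C}) (a : C -> R) u :
  coef u (\sum_(v <- X) a v *: T v) = if u \in X then a u else 0.
Proof.
rewrite linear_sum /=; under eq_bigr do rewrite linearZ /= coef_T.
case: ifPn => uX; last first.
  rewrite big_seq big1 // => v vX; case: eqP => [e|_]; last by rewrite mulr0.
  by rewrite -e vX in uX.
rewrite (big_fsetD1 u) //= eqxx mulr1 big1_fset ?addr0 // => v.
by rewrite !inE => /andP[/negPf -> _]; rewrite mulr0.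
Qed.

(** The defining relations multiply on the left only, so the left factor is peeled. If [w * s i]
    were shorter than [w], then [s j * w * s i] could not be longer than [s j * w]. *)
Lemma mulT_upr i w : (ell w < ell (w * s i)%g)%N -> T w * T (s i) = T (w * s i)%g.
Proof.
elim/cox_length_ind: w => [|j w jw IHw] up; first by rewrite hecke_T1 mul1r mul1g.
have := cox_length_gen j w; have := cox_length_genr i w.
have := cox_length_gen j (w * s i)%g; rewrite cox_mulA => e1 e2 e3.
rewrite -hecke_mulT_up // -mulrA IHw; last by lia.
by rewrite hecke_mulT_up ?cox_mulA //; lia.
Qed.

Lemma mulT_downr i w : (ell (w * s i)%g < ell w)%N ->
  T w * T (s i) = (q - 1) *: T w + q *: T (w * s i)%g.
Proof.
move=> down; have e : w = (w * s i * s i)%g by rewrite cox_mulsK.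
have eT : T w = T (w * s i)%g * T (s i) by rewrite {1}e mulT_upr // -e.
rewrite {1}eT -mulrA hecke_mulT_down; last by rewrite cox_invol cox_length1 cox_length_s.
by rewrite cox_invol hecke_T1 mulrDr -!scalerAr mulr1 -eT.
Qed.

Lemma coef_mulTr_up i u x : (ell u < ell (u * s i)%g)%N ->
  coef u (x * T (s i)) = q * coef (u * s i)%g x.
Proof.
move=> up; elim/hecke_ind: x => [|a x y Ex Ey|w].
- by rewrite mul0r !linear0 mulr0.
- by rewrite mulrDl -scalerAl !linearP /= Ex Ey mulrDr mulrCA.
have wu : (w == u * s i)%g = (w * s i == u)%g by rewrite -(inj_eq (mulIg (s i))) cox_mulsK.
have [e|e] := cox_length_genr i w.
  rewrite mulT_upr ?e // !coef_T wu; case: eqP => [eu|_]; last by rewrite mulr0.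
  by move: up; rewrite -eu cox_mulsK e; lia.
rewrite mulT_downr ?e // linearP linearZ /= !coef_T wu.
case: (w =P u) => [eu|_]; first by move: up; rewrite -eu e; lia.
by rewrite mulr0 add0r.
Qed.

Lemma coef_mulTr_down i u x : (ell (u * s i)%g < ell u)%N ->
  coef u (x * T (s i)) = coef (u * s i)%g x + (q - 1) * coef u x.
Proof.
move=> down; elim/hecke_ind: x => [|a x y Ex Ey|w].
- by rewrite mul0r !linear0 mulr0 addr0.
- by rewrite mulrDl -scalerAl !linearP /= Ex Ey !mulrDr mulrCA addrACA.
have wu : (w == u * s i)%g = (w * s i == u)%g by rewrite -(inj_eq (mulIg (s i))) cox_mulsK.
have [e|e] := cox_length_genr i w.
  rewrite mulT_upr ?e // !coef_T wu; case: (w =P u) => [eu|_]; last by rewrite mulr0 addr0.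
  by move: down; rewrite -eu e; lia.
rewrite mulT_downr ?e // linearP linearZ /= !coef_T wu.
case: (w * s i =P u)%g => [eu|_]; last by rewrite mulr0 addr0 add0r.
by move: down; rewrite -eu cox_mulsK e; lia.
Qed.

(** Generators move one at a time from the left factor to the right one. The term with [q - 1] would
    contribute only for [v = w], which is excluded since [s i] lengthens [v] and shortens [w]. *)
Lemma coef1_TT v w : coef 1%g (T v^-1%g * T w) = (v == w)%:R * q ^+ ell w.
Proof.
elim/cox_length_ind: v w => [|i v up IHv] w.
  rewrite invg1 hecke_T1 mul1r coef_T eq_sym; case: eqP => [<-|_]; last by rewrite mul0r.
  by rewrite cox_length1 mulr1.
rewrite cox_invM cox_genV -mulT_upr; last first.
  by rewrite -[X in (_ < ell X)%N]invgK cox_invM cox_genV invgK !cox_lengthV.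
rewrite -mulrA.
have [e|e] := cox_length_gen i w.
  rewrite hecke_mulT_up ?e // IHv -[in RHS](cox_smulK i w) (inj_eq (mulgI _)).
  case: eqP => [ev|_]; last by rewrite !mul0r.
  by move: up; rewrite ev cox_smulK e; lia.
rewrite hecke_mulT_down ?e // mulrDr -!scalerAr linearP linearZ /= !IHv.
rewrite -[in RHS](cox_smulK i w) (inj_eq (mulgI _)).
case: (v =P w) => [ev|_]; first by move: up; rewrite ev e; lia.
by rewrite cox_smulK e mul0r mulr0 add0r exprS mulrCA.
Qed.

(** On basis elements [coef1_TT] is symmetric, because inversion preserves length. *)
Lemma mu_tildeC x y : mu_tilde B (x * y) = mu_tilde B (y * x).
Proof.
rewrite !mu_tilde_coef.
elim/hecke_ind: x => [|a x z Ex Ez|v]; first by rewrite mulr0 mul0r.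
  by rewrite mulrDl mulrDr -scalerAl -scalerAr !linearP /= Ex Ez.
elim/hecke_ind: y => [|a x z Ex Ez|w]; first by rewrite mulr0 mul0r.
  by rewrite mulrDl mulrDr -scalerAl -scalerAr !linearP /= Ex Ez.
rewrite -{1}[v]invgK -{2}[w]invgK !coef1_TT.
rewrite -(inj_eq invg_inj) invgK eq_sym; case: eqP => [<-|_]; last by rewrite !mul0r.
by rewrite cox_lengthV.
Qed.

Section Folding.
Hypothesis q1 : q != 1.

(* The folding condition is read off the coefficient of [T (w * s j)] in the two
   bracketings of [T (s i) * T w * T (s j)]. *)
Lemma cox_folding i j w :
  (ell w < ell (s i * w)%g)%N -> (ell w < ell (w * s j)%g)%N ->
  (ell (s i * w * s j)%g < ell (s i * w)%g)%N -> (s i * w * s j = w)%g.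
Proof.
move=> up upr down; have e1 := cox_length_gen i w.
have e2 := cox_length_gen i (w * s j)%g; have e3 := cox_length_genr j w.
have e4 := cox_length_genr j (s i * w)%g; rewrite !cox_mulA in e2.
have := congr1 (coef (w * s j)%g) (mulrA (T (s i)) (T w) (T (s j))).
rewrite hecke_mulT_up // mulT_upr // hecke_mulT_down ?cox_mulA; last by lia.
rewrite mulT_downr //  !linearP !linearZ /= !coef_T eqxx mulr1.
case: (s i * w * s j =P w * s j)%g => [e|_].
  by move: e2; rewrite e; lia.
rewrite !mulr0 !addr0; case: (s i * w =P w * s j)%g => [e _|_].
  by rewrite e cox_mulsK.
by rewrite mulr0 => /eqP; rewrite subr_eq0 (negPf q1).
Qed.

(** Either [s j] already shortens the tail, and induction applies, or it lengthens the tail and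
    [cox_folding] deletes the first letter. *)
Lemma cox_exchange l j :
  (ell (cox_prod l * s j)%g < ell (cox_prod l))%N -> ell (cox_prod l) = size l ->
  exists2 n, (n < size l)%N &
    (cox_prod l * s j = cox_prod (take n l ++ drop n.+1 l))%g.
Proof.
elim: l => [|i l IHl]; first by rewrite cox_prod_nil mul1g cox_length1.
rewrite cox_prod_cons /= => down red.
have le := cox_length_prod l; have e1 := cox_length_gen i (cox_prod l).
have e2 := cox_length_genr j (cox_prod l).
case: (ltnP (ell (cox_prod l * s j)%g) (ell (cox_prod l))) => [dn|up].
  have [|n nl en] := IHl dn; first by lia.
  by exists n.+1; rewrite //= cox_prod_cons -en cox_mulA.
exists 0%N; rewrite //= drop0 /=; apply: cox_folding => //; lia.
Qed.

End Folding.
End Coef.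

(** * Parabolic subgroups *)

Section Parabolic.
Variable C : coxeter_system.
Local Notation I := (cox_index C).
Local Notation s := (cox_gen C).
Local Notation ell := (@cox_length C).
Implicit Types (w u v x : C) (i : I) (l : seq I) (K : {set I}).

Definition descents w : {set I} := [set i | (ell (w * s i)%g < ell w)%N]%SET.

Lemma descentsE w i : (i \in descents w) = (ell (w * s i)%g < ell w)%N.
Proof. by rewrite inE. Qed.

Lemma descents1 : descents 1%g = finset.set0.
Proof. by apply/setP => i; rewrite descentsE cox_length1 inE. Qed.

Lemma descents_neq0 w : w != 1%g -> exists i, i \in descents w.
Proof.
have [l lw ew] := cox_reduced_word w; rewrite ew.
case/lastP: l lw ew => [|l i]; first by rewrite cox_prod_nil eqxx.
move=> lw ew _; exists i; rewrite descentsE -ew {1}ew cox_prod_rcons cox_mulsK.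
by rewrite -lw size_rcons ltnS cox_length_prod.
Qed.

Definition parabolic K w : Prop := exists2 l, all (mem K) l & w = cox_prod l.

Lemma parabolic1 K : parabolic K 1%g.
Proof. by exists [::]; rewrite ?cox_prod_nil. Qed.

Lemma parabolicM K u v : parabolic K u -> parabolic K v -> parabolic K (u * v)%g.
Proof.
move=> [l lK ->] [k kK ->]; exists (l ++ k); first by rewrite all_cat lK.
by rewrite cox_prod_cat.
Qed.

Lemma parabolicV K u : parabolic K u -> parabolic K u^-1%g.
Proof.
by move=> [l lK ->]; exists (rev l); [rewrite all_rev|rewrite cox_prodV].
Qed.

Lemma parabolic_gen K i : i \in K -> parabolic K (s i).
Proof.
by move=> iK; exists [:: i]; rewrite ?cox_prod_cons ?cox_prod_nil ?mulg1 //= iK.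
Qed.

Definition layer n : {fset C} := fset_set [set w : C | cox_length w = n].

Lemma mem_layer n w : (w \in layer n) = (ell w == n).
Proof.
rewrite in_fset_set; last exact: finite_length.
by apply/idP/eqP; rewrite inE.
Qed.

Definition ball n : {fset C} := (\bigcup_(k <- iota 0 n.+1) layer k)%fset.

Lemma mem_ball n w : (w \in ball n) = (ell w <= n)%N.
Proof.
apply/bigfcupP/idP => [[k]|wn].
  by rewrite mem_iota mem_layer => kn /eqP ->; lia.
by exists (ell w); rewrite ?mem_layer // mem_iota; lia.
Qed.

(** The ball makes this a finite set by construction. If [K \subset descents w] it is the whole
    coset w W_K, by [mem_coset]. *)
Definition coset K w : {fset C} :=
  [fset u in ball (ell w) | `[< parabolic K (w^-1 * u)%g >]]%fset.

Section Exchange.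
Variables (R : comNzRingType) (q : R) (H : hecke_algebra C q).
Hypothesis q1 : q != 1.

(** The exchange condition only deletes letters, so reducing a word never leaves [K]. *)
Lemma parabolic_reduced K w : parabolic K w ->
  exists l, [/\ all (mem K) l, w = cox_prod l & size l = ell w].
Proof.
move=> [l lK ->]; elim/last_ind: l lK {w} => [_|l i IHl].
  by exists [::]; rewrite cox_prod_nil cox_length1.
rewrite all_rcons => /andP[iK /IHl[k [kK]]].
rewrite cox_prod_rcons; move: (cox_prod l) => w ek sk; have [up|down] := cox_length_genr i w.
  exists (rcons k i); rewrite all_rcons iK kK cox_prod_rcons; split=> //; first by rewrite ek.
  by rewrite size_rcons sk up.
have [||n nk en] := cox_exchange H q1 (l := k) (j := i).
- by rewrite -ek; lia.
- by rewrite -ek.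
exists (take n k ++ drop n.+1 k); rewrite -en ek; split=> //.
  move: kK; rewrite -[k in all _ k -> _](cat_take_drop n) !all_cat => /andP[-> kd].
  by move: kd; rewrite (drop_nth i) //= => /andP[].
rewrite size_cat size_takel ?size_drop; last exact: ltnW.
by rewrite -ek; lia.
Qed.

(** Every reduced word in [K] is a suffix of some reduced word of [w]. When a letter [i] is appended
    to [l], exchange applied to [k ++ l] deletes a letter of [k]. *)
Lemma length_mul_word K w l : K \subset descents w -> all (mem K) l ->
  ell (cox_prod l) = size l -> (ell (w * (cox_prod l)^-1)%g + size l = ell w)%N.
Proof.
move=> /fintype.subsetP Kw; elim/last_ind: l => [|l i IHl].
  by rewrite cox_prod_nil invg1 mulg1 addn0.
rewrite all_rcons size_rcons cox_prod_rcons => /andP[/Kw iw lK] red.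
have lel := cox_length_prod l.
have rl : ell (cox_prod l) = size l by have := cox_length_genr i (cox_prod l); lia.
have {IHl} IH := IHl lK rl.
have [k sk ek] := cox_reduced_word (w * (cox_prod l)^-1)%g.
have ew : w = cox_prod (k ++ l) by rewrite cox_prod_cat -ek mulgVK.
have low := cox_lengthM (w * (cox_prod l * s i)^-1)%g (cox_prod l * s i)%g.
rewrite mulgVK in low.
have [||n] := cox_exchange H q1 (l := k ++ l) (j := i).
- by rewrite -ew -descentsE.
- by rewrite -ew size_cat sk.
rewrite -ew size_cat => nkl; rewrite take_cat drop_cat => en.
(* A deletion inside [l] would make [cox_prod l * s i] shorter than [l], although [rcons l i] is
   reduced. *)
have [nk|kn] := ltnP n (size k); last first.
  have es : (cox_prod l * s i)%g = cox_prod (take (n - size k) l ++ drop (n.+1 - size k) l).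
    apply: (mulgI (cox_prod k)); rewrite -cox_prod_cat catA cox_mulA -cox_prod_cat -ew en.
    by rewrite !ltnNge kn (leqW kn).
  have := cox_length_prod (take (n - size k) l ++ drop (n.+1 - size k) l).
  by rewrite -es red size_cat size_takel ?size_drop; lia.
have es : (w * (cox_prod l * s i)^-1)%g = cox_prod (take n k ++ drop n.+1 k).
  rewrite cox_invM cox_genV cox_mulA en nk.
  case: ltnP => [_|kn]; first by rewrite catA cox_prod_cat mulgK.
  rewrite (_ : (n.+1 - size k = 0)%N) ?drop0; last by lia.
  by rewrite cox_prod_cat mulgK drop_oversize ?cats0.
have := cox_length_prod (take n k ++ drop n.+1 k).
by rewrite -es size_cat size_takel ?size_drop; lia.
Qed.

(** This makes [w] the longest element of w W_K, and bounds the lengths in W_K by that of [w], so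
    that W_K is finite. *)
Lemma length_mul_parabolic K w x : K \subset descents w -> parabolic K x ->
  (ell (w * x)%g + ell x = ell w)%N.
Proof.
move=> Kw xK; have [l [lK el sl]] := parabolic_reduced (parabolicV xK).
rewrite -(length_mul_word Kw lK); last by rewrite -el sl.
by rewrite sl cox_lengthV -el invgK.
Qed.

Lemma mem_coset K w u : K \subset descents w ->
  (u \in coset K w) = `[< parabolic K (w^-1 * u)%g >].
Proof.
move=> Kw; rewrite !inE /= mem_ball andb_idl // => /asboolP ux.
have := length_mul_parabolic Kw ux; rewrite cox_mulA mulgV mul1g.
by move=> <-; exact: leq_addr.
Qed.

Lemma coset_lt K w u : K \subset descents w -> u \in coset K w -> u <> w ->
  (ell u < ell w)%N.
Proof.
move=> Kw; rewrite mem_coset // => /asboolP ux uw.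
have := length_mul_parabolic Kw ux; rewrite cox_mulA mulgV mul1g => <-.
rewrite -[X in (X < _)%N]addn0 ltn_add2l lt0n; apply/eqP => /cox_length_eq0 e.
by apply: uw; rewrite -[u](mulVKg w) e mulg1.
Qed.

Lemma coset_mulr K w u i : K \subset descents w -> i \in K ->
  ((u * s i)%g \in coset K w) = (u \in coset K w).
Proof.
move=> Kw iK; rewrite !mem_coset // cox_mulA; apply/asboolP/asboolP => up.
  by rewrite -(cox_mulsK i (w^-1 * u)%g); apply: parabolicM (parabolic_gen iK).
exact: parabolicM (parabolic_gen iK).
Qed.

(** Lengths in W_K are bounded; no generator in [K] lengthens an element of maximal length. *)
Lemma parabolic_longest K w : K \subset descents w ->
  exists2 v, parabolic K v & K \subset descents v.
Proof.
move=> Kw; pose P n := `[< exists2 x, parabolic K x & ell x = n >].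
have exP : exists n, P n.
  by exists (ell (1%g : C)); apply/asboolP; exists 1%g => //; exact: parabolic1.
have ubP n : P n -> (n <= ell w)%N.
  by move=> /asboolP[x xK <-]; have := length_mul_parabolic Kw xK; lia.
case: (ex_maxnP exP ubP) => n /asboolP[v vK vn] vmax.
exists v => //; apply/fintype.subsetP => i iK; rewrite descentsE.
have := vmax (ell (v * s i)%g); have := cox_length_genr i v.
suff : P (ell (v * s i)%g) by move=> -> + /(_ isT); lia.
by apply/asboolP; exists (v * s i)%g => //; exact: parabolicM (parabolic_gen iK).
Qed.

End Exchange.
End Parabolic.

(** * The left ideals N_K *)

Section Alternating.
Variables (C : coxeter_system) (R : comNzRingType) (q : R) (H : hecke_algebra C q).
Local Notation I := (cox_index C).
Local Notation s := (cox_gen C).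
Local Notation ell := (@cox_length C).
Local Notation T := (hecke_T H).
Implicit Types (w u v : C) (i : I) (K J : {set I}) (x y : H).

Definition alternating K x : Prop := forall i, i \in K -> x * T (s i) = - x.

Lemma alternatingZD K a x y :
  alternating K x -> alternating K y -> alternating K (a * x + y).
Proof.
by move=> xK yK i iK; rewrite mulrDl -mulrA xK // yK // mulrN opprD.
Qed.

Lemma alternatingM K y x : alternating K x -> alternating K (y * x).
Proof. by move=> xK i iK; rewrite -mulrA xK // mulrN. Qed.

Lemma alternatingS K J x : K \subset J -> alternating J x -> alternating K x.
Proof. by move=> /fintype.subsetP KJ xJ i /KJ; exact: xJ. Qed.

Lemma coef_alternating K x i u : alternating K x -> i \in K ->
  (ell u < ell (u * s i)%g)%N -> coef u x = - q * coef (u * s i)%g x.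
Proof.
by move=> xK iK up; rewrite mulNr -coef_mulTr_up // xK // linearN opprK.
Qed.

(** The equation at the longer element of each pair [u], [u * s i] follows from the one at the
    shorter by the quadratic relation. *)
Lemma alternating_coef K x :
  (forall i u, i \in K -> (ell u < ell (u * s i)%g)%N ->
     coef u x = - q * coef (u * s i)%g x) -> alternating K x.
Proof.
move=> xK i iK; apply: coefP => u; rewrite linearN /=.
have [up|down] := cox_length_genr i u.
  by rewrite coef_mulTr_up ?up // (xK i u) ?up // mulNr opprK.
rewrite coef_mulTr_down ?down // (xK i (u * s i)%g) ?cox_mulsK ?down //.
ring.
Qed.

(** If some [i] in [K] lengthened [u], the coefficient at [u] would be [- q] times one at a longer
    element, hence zero. *)
Lemma alternating_descents K x u : alternating K x ->
  (forall v, (ell u < ell v)%N -> coef v x = 0) -> coef u x != 0 ->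
  K \subset descents u.
Proof.
move=> xK top; apply: contraNT => /subsetPn[i iK]; rewrite descentsE -leqNgt => le.
have up : (ell u < ell (u * s i)%g)%N by have := cox_length_genr i u; lia.
by rewrite (coef_alternating xK iK up) top // mulr0.
Qed.

(** No element can carry a leading term, so the bound on the support descends to 0. *)
Lemma alternating_eq0 K x : (forall w, ~~ (K \subset descents w)) ->
  alternating K x -> x = 0.
Proof.
move=> noK xK; have [n] := coef_bounded x.
elim: n => [|n IHn] xn; first by apply: coef_eq0 => u; exact: xn.
apply: IHn => u; rewrite leq_eqVlt => /predU1P[nu|]; last exact: xn.
apply/eqP; apply: contraNT (noK u) => /(alternating_descents xK); apply => v.
by rewrite -nu; exact: xn.
Qed.

Hypothesis q1 : q != 1.

(* If [K \subset descents w], then [w] is the longest element of [w W_K], and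
   [alt_elt K w] is [T w] plus shorter terms. *)
Definition alt_elt K w : H :=
  \sum_(u <- coset K w) (- q) ^+ (ell w - ell u) *: T u.

Lemma coef_alt_elt K w u :
  coef u (alt_elt K w) = if u \in coset K w then (- q) ^+ (ell w - ell u) else 0.
Proof. exact: (hecke_coef_sum H (coset K w) (fun v => (- q) ^+ (ell w - ell v)) u). Qed.

Lemma alt_elt_alternating K w : K \subset descents w -> alternating K (alt_elt K w).
Proof.
move=> Kw; apply: alternating_coef => i u iK up; rewrite !coef_alt_elt.
rewrite (coset_mulr H q1 _ Kw) //; case: ifPn => [uK|_]; last by rewrite mulr0.
have := uK; rewrite -(coset_mulr H q1 _ Kw iK) !inE mem_ball => /andP[le _].
by rewrite -exprS; congr (_ ^+ _); have := cox_length_genr i u; lia.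
Qed.

Lemma coset_self K w : w \in coset K w.
Proof.
rewrite !inE /= mem_ball leqnn; apply/asboolP; rewrite mulVg; exact: parabolic1.
Qed.

Lemma coef_alt_elt_top K w u : K \subset descents w -> (ell w <= ell u)%N ->
  coef u (alt_elt K w) = (u == w)%:R.
Proof.
move=> Kw le; rewrite coef_alt_elt; case: (u =P w) => [->|uw].
  by rewrite coset_self subnn expr0.
by case: ifPn => // /(coset_lt H q1 Kw)/(_ uw); rewrite ltnNge le.
Qed.

Lemma alternating_mul_parabolic K x u : alternating K x -> parabolic K u ->
  x * T u = (-1) ^+ ell u *: x.
Proof.
move=> xK uK; have [l [lK ->]] := parabolic_reduced H q1 uK.
elim/last_ind: l lK {u uK} => [|l i IHl].
  by rewrite cox_prod_nil hecke_T1 mulr1 cox_length1 scale1r.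
rewrite all_rcons => /andP[iK lK] red.
have lel := cox_length_prod l.
rewrite size_rcons cox_prod_rcons in red *.
have e := cox_length_genr i (cox_prod l).
rewrite -mulT_upr; last by lia.
rewrite mulrA IHl //; last by lia.
rewrite -scalerAl xK // -red (_ : size l = ell (cox_prod l)); last by lia.
by rewrite exprS mulN1r scalerN scaleNr.
Qed.

(** For [w] the longest element of W_K this is the eigenvalue of right multiplication by
    [alt_elt K w] on N_K; dividing by it yields e_K. *)
Definition alt_scalar K w : R :=
  \sum_(u <- coset K w) (-1) ^+ ell u * (- q) ^+ (ell w - ell u).

Lemma alternating_mul_alt_elt K w x : parabolic K w -> K \subset descents w ->
  alternating K x -> x * alt_elt K w = alt_scalar K w *: x.
Proof.
move=> wK Kw xK; rewrite mulr_sumr scaler_suml big_seq [RHS]big_seq.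
apply: eq_bigr => u; rewrite (mem_coset H q1) // => /asboolP uK.
have {}uK : parabolic K u by rewrite -[u](mulVKg w); apply: parabolicM.
by rewrite -scalerAr (alternating_mul_parabolic xK) // scalerA mulrC.
Qed.

(** The index representation sends [x * T (s i)] to [q] times the index of [x], and [- x] to its
    opposite. *)
Lemma index_rep_alternating K x : K != finset.set0 -> alternating K x ->
  (1 + q) * index_rep H x = 0.
Proof.
move=> /set0Pn[i iK] /(_ i iK) e.
have eM : index_rep H (x * T (s i)) = index_rep H x * index_rep H (T (s i)).
  exact: rmorphM.
have eN : index_rep H (- x) = - index_rep H x by exact: rmorphN.
move: eM; rewrite e eN index_repT cox_length_s expr1 => /eqP.
by rewrite eq_sym -addr_eq0 mulrC -[X in _ + X]mul1r -mulrDl addrC => /eqP.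
Qed.

End Alternating.

(** * Exactness *)

Section Koszul.
Variables (I : finType) (R : comNzRingType) (V : lmodType R).
Implicit Types (J K : {set I}) (i j : I) (f : {set I} -> V).

Definition koszul_index i J : nat :=
  #|finset (fun j => (j \in J) && (enum_rank j < enum_rank i)%N)|.

Definition koszul_sign i J : R := (-1) ^+ koszul_index i J.

(** The simplicial boundary read componentwise: the value at [J] collects the simplices having [J]
    as a facet, with sign given by the position of the extra vertex. *)
Definition koszul_d f J : V := \sum_(i | i \notin J) koszul_sign i J *: f (i |: J)%SET.

Lemma koszul_sign_setU1 i j J : i \notin J ->
  koszul_sign j (i |: J)%SET =
  if (enum_rank i < enum_rank j)%N then - koszul_sign j J else koszul_sign j J.
Proof.
move=> iJ; rewrite /koszul_sign /koszul_index; case: ifP => ij.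
  rewrite (_ : finset _ = i |: finset (fun k => (k \in J) && (enum_rank k < enum_rank j)%N))%SET.
    by rewrite cardsU1 inE (negPf iJ) exprS mulN1r.
  by apply/setP => k; rewrite !inE; case: (k =P i) => [->|_] /=; rewrite ?ij.
congr (_ ^+ _); apply: eq_card => k; rewrite !inE.
by case: (k =P i) => [->|_] //=; rewrite ij andbF.
Qed.

Lemma koszul_sign_min i J : {in J, forall j, (enum_rank i <= enum_rank j)%N} ->
  koszul_sign i J = 1.
Proof.
move=> imin; rewrite /koszul_sign /koszul_index (_ : finset _ = finset.set0) ?cards0 //.
apply/setP => j; rewrite !inE; apply/negP => /andP[/imin].
by rewrite leqNgt => /negP.
Qed.

Lemma koszul_dd f J : koszul_d (koszul_d f) J = 0.
Proof.
pose r i := (enum_rank i : nat).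
have rneq i j : i != j -> r i != r j by apply: contra => /eqP/val_inj/enum_rank_inj->.
pose F i j : V := koszul_sign i J *: (koszul_sign j (i |: J)%SET *: f (j |: (i |: J))%SET).
pose P i j := [&& i \notin J, j \notin J & i != j].
have -> : koszul_d (koszul_d f) J = \sum_i \sum_(j | P i j) F i j.
  rewrite /koszul_d big_mkcond; apply: eq_bigr => i _; rewrite /P /F.
  case: ifPn => iJ /=; last by rewrite big_pred0.
  rewrite scaler_sumr; apply: eq_bigl => j.
  by rewrite !inE negb_or eq_sym andbC.
(* The ordered pairs are grouped in twos by the rank of their entries; the two terms of a group have
   opposite signs. *)
have -> : \sum_i \sum_(j | P i j) F i j =
    \sum_i \sum_(j | P i j && (r i < r j)%N) (F i j + F j i).
  under eq_bigr => i _ do rewrite (bigID (fun j => (r i < r j)%N)) /=.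
  under [RHS]eq_bigr => i _ do rewrite big_split /=.
  rewrite !big_split /=; congr (_ + _); rewrite (exchange_big_dep xpredT) //=.
  apply: eq_bigr => j _; apply: eq_bigl => i; rewrite /P eq_sym.
  have [->|ij] := eqVneq i j; first by rewrite !andbF.
  rewrite !andbT [(i \notin J) && _]andbC; congr (_ && _).
  by have := rneq _ _ ij; lia.
rewrite big1 // => i _; rewrite big1 // => j /andP[/and3P[iJ jJ ij] lt].
rewrite /F !scalerA !koszul_sign_setU1 // lt ltnNge (ltnW lt) /=.
by rewrite finset.setUCA mulrN scaleNr mulrC addNr.
Qed.

End Koszul.

Section Exactness.
Variables (C : coxeter_system) (R : comNzRingType) (q : R) (H : hecke_algebra C q).
Local Notation I := (cox_index C).
Local Notation s := (cox_gen C).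
Local Notation ell := (@cox_length C).
Local Notation T := (hecke_T H).
Implicit Types (w u v : C) (i : I) (K J : {set I}) (x y : H) (f g : {set I} -> H).

(** Functions on all subsets are kept in every degree, so that [koszul_d] is one map independent of
    [k]. *)
Definition alt_chain k f : Prop :=
  forall K, alternating K (f K) /\ (#|K| <> k -> f K = 0).

Lemma alternatingZ K (a : R) x : alternating K x -> alternating K (a *: x).
Proof. by move=> xK i iK; rewrite -scalerAl xK // scalerN. Qed.

Lemma alternating0 K : alternating K (0 : H).
Proof. by move=> i iK; rewrite mul0r oppr0. Qed.

Lemma alternatingD K x y : alternating K x -> alternating K y -> alternating K (x + y).
Proof. by move=> xK yK i iK; rewrite mulrDl xK // yK // opprD. Qed.

Lemma alt_chain_d k f : alt_chain k.+1 f -> alt_chain k (koszul_d f).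
Proof.
move=> fC J; split.
  apply: big_ind => [|x y xJ yJ|i iJ]; [exact: alternating0|exact: alternatingD|].
  apply: alternatingZ; apply: alternatingS (fC _).1.
  exact: finset.subsetUr.
move=> Jk; rewrite /koszul_d big1 // => i iJ; rewrite (fC _).2 ?scaler0 //.
by rewrite cardsU1 iJ; lia.
Qed.

Lemma index_rep_linear (a : R) x y :
  index_rep H (a *: x + y) = a * index_rep H x + index_rep H y.
Proof. exact: linearP. Qed.

Hypothesis q1 : q != 1.
Hypothesis q1_reg : forall r : R, (1 + q) * r = 0 -> r = 0.

(** Each summand is alternating for a single generator, so [1 + q] annihilates its index. *)
Lemma index_rep_koszul_d f : alt_chain 1 f -> index_rep H (koszul_d f finset.set0) = 0.
Proof.
move=> fC; apply: (big_ind (fun x => index_rep H x = 0)); first exact: linear0.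
  by move=> x y x0 y0; rewrite -[x]scale1r index_rep_linear x0 y0 mulr0 addr0.
move=> i _; apply: q1_reg; apply: (@index_rep_alternating _ _ _ _ [set i]%SET).
  by apply/set0Pn; exists i; rewrite inE.
by apply: alternatingZ; apply: alternatingS (fC _).1; exact: finset.subsetUl.
Qed.

Definition min_descent w : option I :=
  [pick i in descents w | [forall j in descents w, (enum_rank i <= enum_rank j)%N]].

Lemma min_descentP w : w != 1%g -> exists i, [/\ min_descent w = Some i, i \in descents w &
  {in descents w, forall j, (enum_rank i <= enum_rank j)%N}].
Proof.
move=> /descents_neq0[i0 i0w]; rewrite /min_descent; case: pickP => [i|no].
  by move=> /andP[iw /forall_inP imin]; exists i; split.
case: (arg_minnP (fun i => nat_of_ord (enum_rank i)) i0w) => i iw imin.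
have {}iw : i \in descents w := iw.
have := no i; rewrite iw /= => /negP[]; apply/forall_inP; exact: imin.
Qed.

(* The contraction of the simplex on [descents w] to its least vertex, applied to
   leading terms; joining a least vertex has sign 1. *)
Definition contraction f n K : H := \sum_(w <- layer C n)
  (if min_descent w is Some i then
     if i \in K then coef w (f (K :\ i)%SET) else 0 else 0) *:
  alt_elt H (descents w) w.

(** At lengths at least [n] only the leading terms [T w] of the alternating elements are visible. *)
Lemma coef_contraction f n K u : (n <= ell u)%N -> coef u (contraction f n K) =
  if ell u == n then if min_descent u is Some i then
    if i \in K then coef u (f (K :\ i)%SET) else 0 else 0 else 0.
Proof.
move=> nu; rewrite /contraction linear_sum /=.
under eq_big_seq => w wn.
  rewrite linearZ /= coef_alt_elt_top //; last first.
    by move: wn; rewrite mem_layer => /eqP ->.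
  over.
case: eqP => un; last first.
  rewrite big_seq big1 // => w; rewrite mem_layer => /eqP wn.
  by case: eqP => [uw|_]; [rewrite uw wn in un|rewrite mulr0].
rewrite (big_fsetD1 u) /=; last by rewrite mem_layer un.
rewrite eqxx mulr1 big1_fset ?addr0 // => w.
by rewrite !inE eq_sym => /andP[/negPf -> _]; rewrite mulr0.
Qed.

Section Step.
Variables (k n : nat) (f : {set I} -> H).
Hypotheses (fC : alt_chain k f) (f_top : forall K u, (n < ell u)%N -> coef u (f K) = 0).

Lemma top_descents K u : (n <= ell u)%N -> coef u (f K) != 0 -> K \subset descents u.
Proof.
move=> nu nz; apply: (alternating_descents (fC K).1 _ nz) => v uv.
by apply: f_top; exact: leq_ltn_trans uv.
Qed.

(** A summand with nonzero coefficient has [K :\ i] and [i] inside [descents w], hence is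
    alternating for [K]. Positivity of [n] excludes [w = 1], which has no descent. *)
Lemma contraction_chain : (0 < n)%N -> alt_chain k.+1 (contraction f n).
Proof.
move=> n0 K; split=> [|Kk].
  rewrite /contraction big_seq; apply: big_ind; [exact: alternating0|exact: alternatingD|].
  move=> w; rewrite mem_layer => /eqP wn.
  have [i [-> iw _]] : exists i, [/\ min_descent w = Some i, i \in descents w &
      {in descents w, forall j, (enum_rank i <= enum_rank j)%N}].
    by apply: min_descentP; apply: contraTneq n0 => w1; rewrite -wn w1 cox_length1.
  case: ifPn => iK; last by rewrite scale0r; exact: alternating0.
  have [->|nz] := eqVneq (coef w (f (K :\ i)%SET)) 0.
    by rewrite scale0r; exact: alternating0.
  apply/alternatingZ/(alternatingS _ (alt_elt_alternating H q1 (subxx _))).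
  have := top_descents (eq_leq (esym wn)) nz.
  by rewrite -{2}(finset.setD1K iK) finset.subUset finset.sub1set iw.
rewrite /contraction big1 // => w _; case: min_descent => [i|]; last by rewrite scale0r.
case: ifPn => iK; last by rewrite scale0r.
rewrite (fC _).2 ?linear0 ?scale0r //.
by move: Kk; rewrite (cardsD1 i) iK; lia.
Qed.

Lemma coef_koszul_d u g J : coef u (koszul_d g J) =
  \sum_(i | i \notin J) koszul_sign R i J * coef u (g (i |: J)%SET).
Proof. by rewrite linear_sum; apply: eq_bigr => i _; rewrite linearZ. Qed.

(** On cycles the boundary of the contraction restores the leading terms. With [m] the least descent
    of [u], the cases are whether [J] contains [m]. *)
Lemma contraction_top J u : (0 < n)%N -> (forall K, koszul_d f K = 0) ->
  (n <= ell u)%N -> coef u (koszul_d (contraction f n) J) = coef u (f J).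
Proof.
move=> n0 df nu; rewrite coef_koszul_d.
under eq_bigr => i _ do rewrite coef_contraction //.
case: eqP => [un|nun]; last first.
  by rewrite big1 => [|i _]; rewrite ?mulr0 // f_top //; lia.
have [m [-> mu mmin]] : exists i, [/\ min_descent u = Some i, i \in descents u &
      {in descents u, forall j, (enum_rank i <= enum_rank j)%N}].
  by apply: min_descentP; apply: contraTneq n0 => u1; rewrite -un u1 cox_length1.
have sgn1 : koszul_sign R m J * coef u (f J) = coef u (f J).
  have [->|/(top_descents nu)/fintype.subsetP Ju] := eqVneq (coef u (f J)) 0.
    by rewrite mulr0.
  by rewrite koszul_sign_min ?mul1r // => j /Ju; exact: mmin.
(* If [m] is not in [J], only [i = m] contributes, since the contraction at [i |: J] asks for [m] in
   that set. *)
have [mJ|mJ] := boolP (m \in J); last first.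
  rewrite (bigD1 m) //= setU11 finset.setU1K // sgn1 big1 ?addr0 // => i /andP[iJ im].
  by rewrite !inE eq_sym (negPf im) (negPf mJ) mulr0.
(* If [m] is in [J], the cycle condition at [J :\ m] expresses the coefficient of [f J] through the
   other terms, which then match one by one; [m] precedes [i], and this accounts for the sign. *)
have := congr1 (coef u) (df (J :\ m)%SET); rewrite linear0 coef_koszul_d.
rewrite (bigD1 m) /= ?finset.setD1K //; last by rewrite !inE eqxx.
have sgnD : koszul_sign R m (J :\ m)%SET = koszul_sign R m J.
  by rewrite -{2}(finset.setD1K mJ) koszul_sign_setU1 ?ltnn // !inE eqxx.
rewrite sgnD sgn1 => /eqP; rewrite addr_eq0 => /eqP ->.
rewrite -sumrN; apply: eq_big => [i|i iJ].
  rewrite !inE negb_and negbK; case: (i =P m) => [->|_]; rewrite ?mJ ?andbT //=.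
have im : i != m by apply: contraNneq iJ => ->.
have mi : m \in (i |: J)%SET by rewrite !inE mJ orbT.
have e : ((i |: J) :\ m = i |: (J :\ m))%SET.
  by apply/setP => j; rewrite !inE; case: (j =P i) => [->|_] //=; rewrite im.
rewrite mi e; have [->|] := eqVneq (coef u (f (i |: (J :\ m))%SET)) 0.
  by rewrite !mulr0 oppr0.
move=> /(top_descents nu)/fintype.subsetP iu.
rewrite -{1}(finset.setD1K mJ) koszul_sign_setU1 ?inE ?eqxx //.
have := mmin i (iu i _); rewrite setU11 => /(_ isT).
rewrite leq_eqVlt => /predU1P[/val_inj/enum_rank_inj/esym/eqP|->].
  by rewrite (negPf im).
by rewrite mulNr.
Qed.

End Step.

(** Induction on a bound for the support: subtracting the boundary of the contraction removes the
    longest layer and leaves a cycle of the same kind. *)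
Lemma koszul_exact k f : alt_chain k f -> (forall J, koszul_d f J = 0) ->
  (k = 0%N -> index_rep H (f finset.set0) = 0) ->
  exists2 g, alt_chain k.+1 g & forall J, koszul_d g J = f J.
Proof.
move=> fC df ef.
have [n fn] : exists n, forall K u, (n <= ell u)%N -> coef u (f K) = 0.
  have [b bP] := choice (fun K => coef_bounded (f K)).
  exists (\max_K b K) => K u le; apply: bP; apply: leq_trans le.
  exact: leq_bigmax.
elim: n f fC df ef fn => [|n IHn] f fC df ef fn.
  exists (fun=> 0) => [K|J]; first by split=> //; exact: alternating0.
  rewrite /koszul_d big1 => [|i _]; last by rewrite scaler0.
  by apply/esym/coef_eq0 => u; exact: fn.
(* Only [T 1] is left. It has no descents, so [K] is empty and [k = 0], and the index condition
   kills its coefficient. *)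
have [n0|n0] := posnP n.
  suff f0 K : f K = 0.
    exists (fun=> 0) => [K|J]; first by split=> //; exact: alternating0.
    by rewrite /koszul_d big1 => [|i _]; rewrite ?scaler0 ?f0.
  have f1 u : u != 1%g -> coef u (f K) = 0.
    move=> u1; apply: fn; rewrite n0 lt0n; apply: contra u1 => /eqP.
    by move/cox_length_eq0 ->.
  have fK : f K = coef 1%g (f K) *: T 1%g.
    apply: coefP => u; rewrite linearZ /= coef_T.
    by have [<-|u1] := eqVneq 1%g u; rewrite ?mulr1 ?mulr0 // f1 // eq_sym.
  have [c0|nz] := eqVneq (coef 1%g (f K)) 0; first by rewrite fK c0 scale0r.
  have K0 : K = finset.set0.
    apply/eqP; rewrite -finset.subset0.
    have ft K' v : (0 < ell v)%N -> coef v (f K') = 0 by move=> v0; apply: fn; rewrite n0.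
    by have := top_descents fC ft (leq0n _) nz; rewrite descents1.
  have [k0|k0] := posnP k; last first.
    have [_ ->] := fC K => //; rewrite K0 cards0; lia.
  have := ef k0; rewrite -K0 fK.
  have -> : index_rep H (coef 1%g (f K) *: T 1%g) = coef 1%g (f K) * index_rep H (T 1%g).
    exact: linearZ.
  by rewrite index_repT cox_length1 mulr1 => ->; rewrite scale0r.
pose y := contraction f n; have yC : alt_chain k.+1 y by exact: contraction_chain fC _ n0.
have dyC := alt_chain_d yC.
have [] := IHn (fun K => f K - koszul_d y K).
- move=> K; split; last by move=> Kk; rewrite (fC K).2 // (dyC K).2 // subrr.
  by rewrite addrC -scaleN1r; apply: alternatingD (fC K).1; apply: alternatingZ (dyC K).1.
- move=> J; rewrite -[RHS](subrr 0) -{1}(df J) -(koszul_dd y J) /koszul_d -sumrB.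
  by apply: eq_bigr => i _; rewrite scalerBr.
- move=> k0; rewrite addrC -scaleN1r index_rep_linear ef // addr0.
  rewrite index_rep_koszul_d ?mulr0 // -?k0 //.
- move=> K u nu; rewrite linearB /= (contraction_top fC fn) ?subrr //.
move=> g gC dg; exists (fun K => y K + g K).
  move=> K; split; first by apply: alternatingD; [exact: (yC K).1|exact: (gC K).1].
  by move=> Kk; rewrite (yC K).2 // (gC K).2 // addr0.
move=> J; rewrite /koszul_d; under eq_bigr do rewrite scalerDr.
rewrite big_split /= -[X in _ + X]/(koszul_d g J) dg -[X in X + _]/(koszul_d y J).
by rewrite addrC subrK.
Qed.

End Exactness.

(** * Power series and the Poincare series *)

Section PowerSeries.
Variable R : comNzRingType.
Implicit Types (f g : fps R) (n k : nat).

Lemma fps_coefM f g n :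
  fps_coef (f * g) n = \sum_(i < n.+1) fps_coef f i * fps_coef g (n - i).
Proof. by []. Qed.

Lemma fps_coef1 n : fps_coef (1 : fps R) n = (n == 0%N)%:R.
Proof. by []. Qed.

Lemma fps_coef_sum (J : Type) (r : seq J) (P : pred J) (F : J -> fps R) n :
  fps_coef (\sum_(j <- r | P j) F j) n = \sum_(j <- r | P j) fps_coef (F j) n.
Proof. exact: (big_morph (fun f => fps_coef f n) (fun f g => erefl) erefl). Qed.

Lemma fps_coef_signM k f n : fps_coef ((-1) ^+ k * f) n = (-1) ^+ k * fps_coef f n.
Proof.
by rewrite -signr_odd -[in RHS]signr_odd; case: odd; rewrite ?expr0 ?expr1 ?mul1r ?mulN1r.
Qed.

Lemma fps_coefXM f n :
  fps_coef (fpsX R * f) n = if n is m.+1 then fps_coef f m else 0.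
Proof.
rewrite fps_coefM big_ord_recl /= mul0r add0r; case: n => [|n]; first by rewrite big_ord0.
by rewrite big_ord_recl /= mul1r big1 ?addr0 ?subSS ?subn0 // => i _; rewrite mul0r.
Qed.

Lemma fps_coefXnM k f n :
  fps_coef (fpsX R ^+ k * f) n = if (k <= n)%N then fps_coef f (n - k) else 0.
Proof.
elim: k n => [|k IHk] n; first by rewrite expr0 mul1r subn0.
by rewrite exprS -mulrA fps_coefXM; case: n => // n; rewrite IHk.
Qed.

Lemma fps_coefXn0 k : fps_coef (fpsX R ^+ k) 0 = (k == 0%N)%:R.
Proof. by rewrite -[_ ^+ k]mulr1 fps_coefXnM leqn0; case: k. Qed.

Lemma fps_unit1 f : fps_coef f 0 = 1 -> f \is a GRing.unit.
Proof.
move=> f0.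
(* Each coefficient of the inverse depends on all earlier ones, so the recursion builds the list
   [G n] of the first [n.+1]. *)
pose G := fix G n : seq R := if n is m.+1 then
  rcons (G m) (- \sum_(i < m.+1) (G m)`_i * fps_coef f (m.+1 - i)) else [:: 1].
have sG n : size (G n) = n.+1 by elim: n => //= n IHn; rewrite size_rcons IHn.
have GE m n i : (i <= n)%N -> (G (n + m)%N)`_i = (G n)`_i.
  move=> le; elim: m => [|m IHm]; first by rewrite addn0.
  by rewrite addnS /= nth_rcons sG ltnS (leq_trans le) ?leq_addr.
pose g : fps R := Fps (fun n => (G n)`_n).
apply/asboolP; exists g; apply: fpsP => n; rewrite fps_coefM fps_coef1.
case: n => [|n]; first by rewrite big_ord_recl big_ord0 /= f0 mulr1 addr0.
rewrite big_ord_recr /= subnn f0 mulr1 nth_rcons sG ltnn eqxx.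
apply/eqP; rewrite subr_eq0; apply/eqP; apply: eq_bigr => i _.
by rewrite -(GE (n - i)%N i) // subnKC // -ltnS.
Qed.

End PowerSeries.

(** Expand the product over [i] of 1 minus the indicator of [D]. *)
Lemma sum_subset_sign (I : finType) (R : comNzRingType) (D : {set I}) :
  \sum_(K : {set I} | K \subset D) (-1) ^+ #|K| = (D == finset.set0)%:R :> R.
Proof.
transitivity (\prod_(i : I) (- (i \in D)%:R + 1) : R).
  rewrite bigA_distr [LHS]big_mkcond; apply: eq_bigr => K _.
  rewrite -big_mkcond /= prodrN; case: ifPn => [/fintype.subsetP KD|].
    by rewrite big1 ?mulr1 // => i /KD ->.
  by case/subsetPn => i iK iD; rewrite (bigD1 i iK) /= (negPf iD) mul0r mulr0.
have [->|/set0Pn[i iD]] := eqVneq D finset.set0.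
  by rewrite big1 // => i _; rewrite inE oppr0 add0r.
by rewrite (bigD1 i) //= iD addNr mul0r.
Qed.

Section Poincare.
Variables (C : coxeter_system) (H : hecke_algebra C (fpsX int)).
Local Notation I := (cox_index C).
Local Notation s := (cox_gen C).
Local Notation ell := (@cox_length C).
Local Notation T := (hecke_T H).
Local Notation q := (fpsX int).
Implicit Types (w u v x : C) (i : I) (K J : {set I}) (h : H).

Lemma fpsX_neq1 : q != 1.
Proof. by apply/eqP => /(congr1 (fun f => fps_coef f 0)). Qed.

Lemma fpsX1_reg (r : fps int) : (1 + q) * r = 0 -> r = 0.
Proof.
have u : 1 + q \is a GRing.unit by apply: fps_unit1.
by move=> e; apply: (mulrI u); rewrite e mulr0.
Qed.

Lemma poincareE n : fps_coef (poincare C) n = \sum_(w <- layer C n) 1.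
Proof. by rewrite big_const_seq count_predT iter_addr_0 natz. Qed.

Lemma layer0 : layer C 0 = [fset 1%g]%fset.
Proof.
apply/fsetP => w; rewrite mem_layer !inE; apply/eqP/eqP => [/cox_length_eq0 //|->].
exact: cox_length1.
Qed.

Lemma poincare_unit : poincare C \is a GRing.unit.
Proof. by apply: fps_unit1; rewrite poincareE layer0 big_seq_fset1. Qed.

Definition descent_series K : fps int :=
  Fps (fun n => \sum_(w <- layer C n) (K \subset descents w)%:R).

Lemma sum_descent_series : \sum_(K : {set I}) (-1) ^+ #|K| * descent_series K = 1.
Proof.
apply: fpsP => n; rewrite fps_coef_sum.
under eq_bigr do rewrite fps_coef_signM /= mulr_sumr.
rewrite exchange_big /=; under eq_bigr => w _.
  under eq_bigr do rewrite mulr_natr mulrb.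
  rewrite -big_mkcond sum_subset_sign.
  over.
case: n => [|n].
  by rewrite layer0 big_seq_fset1 descents1 eqxx.
rewrite big_seq big1 // => w; rewrite mem_layer => wn.
have /descents_neq0[i iw] : w != 1%g.
  by apply: contraTneq wn => ->; rewrite cox_length1.
by case: eqP => // e; rewrite e inE in iw.
Qed.

Section Coset.
Variables (K : {set I}) (w : C).
Hypotheses (wK : parabolic K w) (Kw : K \subset descents w).

(** Here [w] is the longest element of W_K, so [coset K w] enumerates W_K itself. *)
Lemma coset_parabolic u : u \in coset K w = `[< parabolic K u >].
Proof.
rewrite (mem_coset H fpsX_neq1) //; apply/asboolP/asboolP => uK.
  by rewrite -[u](mulVKg w); apply: parabolicM.
by apply: parabolicM => //; apply: parabolicV.
Qed.

Lemma parabolic_le u v : parabolic K u -> K \subset descents v -> (ell u <= ell v)%N.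
Proof. by move=> uK /(length_mul_parabolic H fpsX_neq1)/(_ uK); lia. Qed.

(** Take an element of maximal length in x W_K; the lengths there are at most [ell x + ell w]. *)
Lemma coset_max (x : C) : exists2 u, parabolic K u & K \subset descents (x * u^-1)%g.
Proof.
pose P n := `[< exists2 u, parabolic K u & ell (x * u)%g = n >].
have exP : exists n, P n.
  by exists (ell (x * 1)%g); apply/asboolP; exists 1%g => //; exact: parabolic1.
have ubP n : P n -> (n <= ell x + ell w)%N.
  move=> /asboolP[u uK <-]; apply: leq_trans (cox_lengthM _ _) _.
  by rewrite leq_add2l parabolic_le.
case: (ex_maxnP exP ubP) => n /asboolP[u uK un] umax.
exists u^-1%g; first exact: parabolicV.
rewrite invgK; apply/fintype.subsetP => i iK; rewrite descentsE.
have := umax (ell (x * u * s i)%g); have := cox_length_genr i (x * u)%g.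
suff : P (ell (x * u * s i)%g) by move=> -> + /(_ isT); lia.
apply/asboolP; exists (u * s i)%g; last by rewrite cox_mulA.
exact: parabolicM (parabolic_gen iK).
Qed.

(** Each of the two coset elements is at least as long as the other, by exactly the length of the
    quotient; so the quotient has length 0. *)
Lemma coset_max_uniq (x : C) u v : parabolic K u -> parabolic K v ->
  K \subset descents (x * u^-1)%g -> K \subset descents (x * v^-1)%g -> u = v.
Proof.
move=> uK vK du dv.
have h a b : parabolic K a -> parabolic K b -> K \subset descents (x * a^-1)%g ->
    (ell (x * b^-1)%g + ell (a * b^-1)%g = ell (x * a^-1)%g)%N.
  move=> aK bK da.
  have := length_mul_parabolic H fpsX_neq1 da (parabolicM aK (parabolicV bK)).
  by rewrite cox_mulA mulgVK.
have := h _ _ uK vK du; have := h _ _ vK uK dv => h1 h2.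
have /cox_length_eq0 e : ell (u * v^-1)%g = 0%N by lia.
by rewrite -[u](mulgVK v) e mul1g.
Qed.

(** Every [x] is uniquely [v * u] with [u] in W_K and [v] longest in its coset, and then [v] has
    length [ell x + ell u]. *)
Lemma poincare_coset n : fps_coef (poincare C) n =
  \sum_(u <- coset K w) fps_coef (descent_series K) (n + ell u).
Proof.
have -> : fps_coef (poincare C) n =
    \sum_(x <- layer C n) \sum_(u <- coset K w) (K \subset descents (x * u^-1)%g)%:R.
  rewrite poincareE; apply: eq_bigr => x _; have [u uK du] := coset_max x.
  rewrite (big_fsetD1 u) /=; last by rewrite coset_parabolic; apply/asboolP.
  rewrite du big1_fset ?addr0 // => v; rewrite in_fsetD1 coset_parabolic.
  move=> /andP[vu /asboolP vK] _; case: (boolP (_ \subset _)) => // dv.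
  by rewrite (coset_max_uniq vK uK dv du) eqxx in vu.
rewrite exchange_big big_seq [RHS]big_seq /=; apply: eq_bigr => u.
rewrite coset_parabolic => /asboolP uK.
rewrite (eq_bigr (fun x => if K \subset descents (x * u^-1)%g then 1 else 0)); last first.
  by move=> x _; case: ifP.
rewrite [RHS](eq_bigr (fun v => if K \subset descents v then 1 else 0)); last first.
  by move=> x _; case: ifP.
rewrite -!big_mkcond [LHS]big_fset_condE [RHS]big_fset_condE.
rewrite (_ : [fset v in layer C (n + ell u) | K \subset descents v]%fset =
  [fset (x * u^-1)%g | x in [fset x in layer C n | K \subset descents (x * u^-1)%g]]%fset).
  by rewrite [RHS]big_imfset // => x y _ _ /mulIg.
apply/fsetP => v; apply/idP/imfsetP => /=; rewrite !inE.
  move=> /andP[vn dv]; exists ((v : C) * u)%g; last by rewrite mulgK.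
  rewrite !inE /= mulgK dv andbT mem_layer; move: vn; rewrite mem_layer.
  by have := length_mul_parabolic H fpsX_neq1 dv uK; lia.
move=> [x]; rewrite !inE /= !mem_layer => /andP[xn dx] ->; rewrite dx andbT.
have := length_mul_parabolic H fpsX_neq1 dx uK; rewrite mulgVK => e.
by apply/eqP; rewrite -(eqP xn); exact: esym e.
Qed.

(** This is [poincare_coset] with the negative powers of [q] cleared by the factor [q ^+ ell w]; all
    terms of [alt_scalar] carry the common sign [(-1) ^+ ell w]. *)
Lemma poincare_descent_series :
  poincare C * (- q) ^+ ell w = descent_series K * alt_scalar q K w.
Proof.
have -> : alt_scalar q K w = \sum_(u <- coset K w) (-1) ^+ ell w * q ^+ (ell w - ell u).
  rewrite /alt_scalar big_seq [RHS]big_seq; apply: eq_bigr => u uw.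
  rewrite (exprNn q) mulrA -exprD subnKC //; apply: parabolic_le => //.
  by apply/asboolP; rewrite -coset_parabolic.
rewrite -mulr_sumr (exprNn q) mulrCA [RHS]mulrCA; congr (_ * _).
rewrite mulrC mulr_sumr; apply: fpsP => n; rewrite fps_coef_sum fps_coefXnM.
under eq_bigr do rewrite mulrC fps_coefXnM.
case: leqP => [le|lt].
  rewrite poincare_coset big_seq [RHS]big_seq; apply: eq_bigr => u.
  rewrite coset_parabolic => /asboolP/parabolic_le/(_ Kw) uw.
  by rewrite (leq_trans (leq_subr _ _) le); congr (fps_coef _ _); lia.
(* Below degree [ell w] both sides vanish: an element whose descents contain [K] is at least as long
   as [w]. *)
rewrite big_seq big1 // => u; rewrite coset_parabolic => /asboolP/parabolic_le/(_ Kw) uw.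
case: ifP => // _; rewrite /= big_seq big1 // => v; rewrite mem_layer => /eqP vn.
case: (boolP (_ \subset _)) => // /(parabolic_le wK); lia.
Qed.

Lemma alt_scalar_unit : alt_scalar q K w \is a GRing.unit.
Proof.
(* Only [u = w] contributes to the constant term, which is [(-1) ^+ ell w]; the sign is split off to
   make it 1. *)
have e : alt_scalar q K w = (-1) ^+ ell w * ((-1) ^+ ell w * alt_scalar q K w).
  by rewrite mulrA -exprMn mulrNN mulr1 expr1n mul1r.
rewrite e unitrM unitrX ?unitrN1 //=; apply: fps_unit1.
rewrite fps_coef_signM /alt_scalar fps_coef_sum (big_fsetD1 w); last exact: coset_self.
rewrite big1_fset => [|u]; last first.
  rewrite in_fsetD1 => /andP[uw uK] _; rewrite fps_coef_signM (exprNn q) fps_coef_signM.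
  rewrite fps_coefXn0 (_ : (ell w - ell u == 0)%N = false) ?mulr0 //.
  have := coset_lt H fpsX_neq1 Kw uK; move/eqP: uw => uw /(_ uw); lia.
rewrite [X in _ * X]addr0 fps_coef_signM subnn expr0 fps_coef1 mulr1 -exprMn mulrNN mulr1.
by rewrite expr1n.
Qed.

End Coset.

(** If no descent set contains [K], both N_K and the series are zero and 0 serves. Otherwise
    [alt_elt] at the longest [v] of W_K is normalized; its coefficient at 1 is [(- q) ^+ ell v], as
    [poincare_descent_series] requires. *)
Lemma alternating_idempotent : exists e : {set I} -> H, forall K,
  [/\ alternating K (e K), forall h : H, alternating K h -> h * e K = h &
      poincare C * coef 1%g (e K) = descent_series K].
Proof.
suff /choice[e eP] : forall K, exists e : H, [/\ alternating K e,
    forall h : H, alternating K h -> h * e = h &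
    poincare C * coef 1%g e = descent_series K] by exists e.
move=> K; have [[w Kw]|noK] := pselect (exists w, K \subset descents w); last first.
  have {}noK w : ~~ (K \subset descents w) by apply/negP => Kw; apply: noK; exists w.
  exists 0; split; first by move=> i _; rewrite mul0r oppr0.
    by move=> x /(alternating_eq0 noK) ->; rewrite mulr0.
  rewrite linear0 mulr0; apply: fpsP => n /=.
  by rewrite big1 // => w _; rewrite (negPf (noK w)).
have [v vK Kv] := parabolic_longest H fpsX_neq1 Kw.
have u := alt_scalar_unit Kv; exists ((alt_scalar q K v)^-1 *: alt_elt H K v); split.
- by move=> i iK; rewrite -scalerAl (alt_elt_alternating H fpsX_neq1) // scalerN.
- move=> x xK; rewrite -scalerAr (alternating_mul_alt_elt fpsX_neq1) //.
  by rewrite scalerA mulVr // scale1r.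
rewrite linearZ /= coef_alt_elt coset_parabolic //.
case: asboolP => [_|[]]; last exact: parabolic1.
by rewrite cox_length1 subn0 mulrCA (poincare_descent_series vK Kv) mulrCA mulVr // mulr1.
Qed.

End Poincare.

(** * The resolution *)

Section ChainModule.
Variables (C : coxeter_system) (R : comNzRingType) (q : R) (H : hecke_algebra C q).
Local Notation I := (cox_index C).
Local Notation F := {ffun {set I} -> H^o}.

Section Degree.
Variable k : nat.

Definition alt_pred : {pred F} := fun f => `[< alt_chain (H := H) k f >].

Fact alt_pred_submod : submod_closed alt_pred.
Proof.
split=> [|a f g /asboolP fC /asboolP gC]; apply/asboolP => K.
  by rewrite ffunE; split=> //; exact: alternating0.
split=> [|Kk]; rewrite !ffunE; first exact: alternatingZD (fC K).1 (gC K).1.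
by rewrite (fC K).2 // (gC K).2 // scaler0 addr0.
Qed.
HB.instance Definition _ := GRing.isSubmodClosed.Build _ _ alt_pred alt_pred_submod.

Record alt_module := AltModule { alt_val :> F; _ : alt_val \in alt_pred }.
HB.instance Definition _ := [isSub for alt_val].
HB.instance Definition _ := [Choice of alt_module by <:].
HB.instance Definition _ := [SubChoice_isSubLmodule of alt_module by <:].

Lemma alt_moduleP (f : alt_module) : alt_chain (H := H) k f.
Proof. exact/asboolP/(valP f). Qed.

Definition alt_pack (f : {set I} -> H) (fC : alt_chain (H := H) k f) : alt_module.
Proof.
apply: (@AltModule [ffun K => f K]); apply/asboolP => K; rewrite ffunE; exact: fC.
Defined.

Lemma alt_packE f fC K : @alt_pack f fC K = f K.
Proof. by rewrite ffunE. Qed.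

Lemma alt_module_eq (f g : alt_module) : (forall K, f K = g K) -> f = g.
Proof. by move=> fg; apply: val_inj; apply/ffunP. Qed.

Lemma alt_linE (a : H) (f g : alt_module) K : (a *: f + g) K = a * f K + g K.
Proof. by rewrite /= !ffunE. Qed.

End Degree.

Lemma koszul_d_linear (a : H) (f g : {set I} -> H) J :
  koszul_d (fun K => a * f K + g K) J = a * koszul_d f J + koszul_d g J.
Proof.
rewrite mulr_sumr -big_split; apply: eq_bigr => i _ /=.
by rewrite scalerDr scalerAr.
Qed.

Definition alt_d k (f : alt_module k.+1) : alt_module k :=
  alt_pack (alt_chain_d (alt_moduleP f)).

Fact alt_d_linear k : linear_for *:%R (@alt_d k).
Proof.
move=> a f g; apply: alt_module_eq => K; rewrite alt_linE !alt_packE -koszul_d_linear.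
by apply: eq_bigr => i _; rewrite alt_linE.
Qed.

Definition alt_aug (f : alt_module 0) : lambda_module (index_rep H) :=
  index_rep H (f finset.set0).

Fact alt_aug_linear : linear_for *:%R alt_aug.
Proof.
move=> a f g; rewrite /alt_aug alt_linE.
have -> : index_rep H (a * f finset.set0 + g finset.set0) =
    index_rep H (a * f finset.set0) + index_rep H (g finset.set0) by exact: raddfD.
by congr (_ + _); exact: rmorphM.
Qed.

Section Projection.
Variable e : {set I} -> H.
Hypothesis eK : forall K, alternating K (e K).
Hypothesis e_id : forall K (h : H), alternating K h -> h * e K = h.
Variable k : nat.

(** Right multiplication by [e K] commutes with the left action and projects the regular module onto
    N_K, so the chains of degree [k] are a retract of a finite free module. *)
Fact alt_proj_chain (f : F) :
  alt_chain (H := H) k (fun K => if #|K| == k then (f K : H) * e K else 0).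
Proof.
by move=> K; case: eqP => [Kk|_]; split=> //; [exact: alternatingM|exact: alternating0].
Qed.

Definition alt_proj (f : F) : alt_module k := alt_pack (alt_proj_chain f).

Fact alt_proj_linear : linear_for *:%R alt_proj.
Proof.
move=> a f g; apply: alt_module_eq => K; rewrite alt_linE !alt_packE !ffunE.
by case: ifP => _; rewrite ?mulr0 ?addr0 // mulrDl -mulrA.
Qed.

Let i : {linear alt_module k -> F} := linear_pack (f := @alt_val k) (fun _ _ _ => erefl).
Let p : {linear F -> alt_module k} := linear_pack alt_proj_linear.

Lemma alt_projK : cancel i p.
Proof.
move=> f; apply: alt_module_eq => K; rewrite [LHS](alt_packE (alt_proj_chain (alt_val f))) /=.
have [fK nk] := alt_moduleP f K; case: eqP => [_|/nk -> //]; exact: e_id.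
Qed.

Definition alt_basis : seq (dual_module (alt_module k) * alt_module k) :=
  retract_basis i p.

Lemma alt_dual_basis : dual_basis alt_basis.
Proof. exact: retract_dual_basis alt_projK. Qed.

Lemma alt_mod_trace (tau : {additive H -> R}) :
  mod_trace tau alt_basis (fun x => x) = \sum_(K : {set I} | #|K| == k) tau (e K).
Proof.
rewrite /mod_trace big_map big_enum [RHS]big_mkcond; apply: eq_bigr => K _ /=.
rewrite ffunE ffunE eqxx; case: ifP => _; rewrite ?mul1r // raddf0 //.
Qed.

End Projection.
End ChainModule.

Section Resolution.
Variables (C : coxeter_system) (R : comNzRingType) (q : R) (H : hecke_algebra C q).
Hypothesis q1 : q != 1.
Hypothesis q1_reg : forall r : R, (1 + q) * r = 0 -> r = 0.
Variable e : {set cox_index C} -> H.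
Hypothesis eK : forall K, alternating K (e K).
Hypothesis e_id : forall K (h : H), alternating K h -> h * e K = h.

Definition alt_resolution : fp_resolution (lambda_module (index_rep H)).
Proof.
apply: (@FPResolution _ _ #|cox_index C| (fun k => alt_module H k)
  (fun k => linear_pack (@alt_d_linear _ _ _ H k)) (linear_pack (@alt_aug_linear _ _ _ H))).
- move=> k; exact: dual_basis_fg (alt_dual_basis (k := k) eK e_id).
- move=> k; exact: dual_basis_projective (alt_dual_basis (k := k) eK e_id).
- move=> k Ik f; apply: alt_module_eq => K; rewrite (alt_moduleP f K).2 ?ffunE //.
  by move=> e0; have := max_card (mem K); rewrite e0 leqNgt Ik.
- move=> r.
  (* A preimage of [r] is [r] times the unit, placed at the empty set. *)
  have rC : alt_chain (H := H) 0 
      (fun K => if K == finset.set0 then (r : R) *: hecke_T H 1%g else 0).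
    move=> K; case: eqP => [->|K0]; split=> //; try exact: alternating0.
      by move=> i; rewrite inE.
    by rewrite cards0.
  exists (alt_pack rC); rewrite /= /alt_aug alt_packE eqxx.
  have -> : index_rep H ((r : R) *: hecke_T H 1%g) = (r : R) * index_rep H (hecke_T H 1%g).
    exact: linearZ.
  by rewrite index_repT cox_length1 mulr1.
- move=> f; split=> [f0|[g <-]]; last first.
    rewrite /= /alt_aug alt_packE; apply: index_rep_koszul_d => //; exact: alt_moduleP.
  have [|_|g gC dg] := koszul_exact q1 q1_reg (alt_moduleP f).
  (* In degree 0 the cycle condition is automatic, as the chain vanishes on nonempty sets. *)
  + move=> J; rewrite /koszul_d big1 // => i iJ.
    by rewrite (alt_moduleP f _).2 ?scaler0 // cardsU1 iJ.
  + exact: f0.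
  exists (alt_pack gC); apply: alt_module_eq => K; rewrite alt_packE -dg.
  by apply: eq_bigr => i _; rewrite alt_packE.
- move=> k f; split=> [f0|[g <-]]; last first.
    apply: alt_module_eq => K; rewrite alt_packE ffunE -[RHS](koszul_dd g K).
    by apply: eq_bigr => i _; rewrite alt_packE.
  have [J|//|g gC dg] := koszul_exact q1 q1_reg (alt_moduleP f).
    by have := congr1 (fun h : alt_module H k => h J) f0; rewrite alt_packE ffunE.
  exists (alt_pack gC); apply: alt_module_eq => K; rewrite alt_packE -dg.
  by apply: eq_bigr => i _; rewrite alt_packE.
Defined.

End Resolution.

Theorem theoremA (C : coxeter_system) (H : hecke_algebra C (fpsX int)) :
  [/\ is_euler_algebra (hecke_basis H) (index_rep H),
      poincare C \is a GRing.unit &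
      euler_char (hecke_basis H) (index_rep H) = (poincare C)^-1].
Proof.
have [e eP] := alternating_idempotent H.
have eK K : alternating K (e K) by have [] := eP K.
have e_id K (h : H) : alternating K h -> h * e K = h by have [_ + _] := eP K; apply.
pose Q := alt_resolution (fpsX_neq1) fpsX1_reg eK e_id.
have B_basis : is_basis (hecke_basis H) := @hecke_T_basis _ _ _ H.
have pU := poincare_unit C.
split; [|exact: pU|].
  split; [exact: B_basis| |by constructor|exact: mu_tildeC].
  by exists 1%g; [|exact: hecke_T1].
rewrite (@euler_char_resolution _ _ _ _ B_basis (@mu_tildeC _ _ _ H) Q
  (fun k => alt_basis eK k)); last first.
  by move=> k; exact: alt_dual_basis.
set tau := mu_tilde_linear B_basis.
have -> : euler_trace (P := Q) tau (fun k => alt_basis eK k) (res_len Q).+1 (fun k x => x) =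
    \sum_(K : {set cox_index C}) (-1) ^+ #|K| * tau (e K).
  (* The subsets are sorted by cardinality, that is, by the degree in which their idempotent
     enters. *)
  pose d (K : {set cox_index C}) : 'I_#|cox_index C|.+1 := inord #|K|.
  have dE K : d K = #|K| :> nat by rewrite inordK // ltnS max_card.
  rewrite (partition_big d xpredT) //=; apply: eq_bigr => k _.
  rewrite [X in _ * X](alt_mod_trace eK k tau) mulr_sumr; apply: eq_big => K.
    by rewrite -val_eqE /= dE.
  by move=> /eqP ->.
(* After multiplication by the Poincare series each term becomes a signed descent series, and these
   sum to 1. *)
apply: (mulrI pU); rewrite mulrV // -[RHS](sum_descent_series C) mulr_sumr.
apply: eq_bigr => K _; rewrite mulrCA; have [_ _ <-] := eP K.
by rewrite -mu_tilde_coef.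
Qed.
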